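(* Let $\nu>0$ and consider on the real line $x\in\mathbb{R}$ the equation $\omega_t=\omega\,\mathcal{H}(\omega)-\nu\Lambda\omega$. Consider the ansatz with two pairs of complex conjugate simple poles $$\omega(x,t)=\frac{\omega_{-1,1}(t)}{x-iv_{c,1}(t)}+\frac{\overline{\omega_{-1,1}(t)}}{x+i\,\overline{v_{c,1}(t)}}+\frac{\omega_{-1,2}(t)}{x-iv_{c,2}(t)}+\frac{\overline{\omega_{-1,2}(t)}}{x+i\,\overline{v_{c,2}(t)}},$$ with complex initial values $\omega_{-1,1}(0),\omega_{-1,2}(0),v_{c,1}(0),v_{c,2}(0)$ such that $\mathrm{Re}[v_{c,1}(0)]>0$, $\mathrm{Re}[v_{c,2}(0)]>0$ and $v_{c,1}(0)\neq v_{c,2}(0)$. As long as $\mathrm{Re}[v_{c,1}(t)]>0$ and $\mathrm{Re}[v_{c,2}(t)]>0$, this $\omega$ satisfies the equation identically when $$\frac{dv_{c,1}}{dt}=\nu+\omega_{-1,1},\qquad \frac{dv_{c,2}}{dt}=\nu+\omega_{-1,2},\qquad \frac{d\omega_{-1,1}}{dt}=\frac{2\omega_{-1,1}\omega_{-1,2}}{v_{c,1}-v_{c,2}},\qquad \frac{d\omega_{-1,2}}{dt}=\frac{2\omega_{-1,1}\omega_{-1,2}}{v_{c,2}-v_{c,1}}.$$ Put $c_0=\omega_{-1,1}(0)+\omega_{-1,2}(0)$ and $c_1=\omega_{-1,1}(0)-\omega_{-1,2}(0)$; then $\omega_{-1,1}(t)+\omega_{-1,2}(t)=c_0$ for all $t$.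 With the principal branch of the square root, the solution of this system is as follows. If $c_0\neq0$: $$\omega_{-1,1}(t)=\frac{c_0}{2}+\frac12\,\frac{c_1+\frac{c_0^2t}{v_{c,1}(0)-v_{c,2}(0)}}{\sqrt{1+\frac{2c_1t}{v_{c,1}(0)-v_{c,2}(0)}+\frac{c_0^2t^2}{(v_{c,1}(0)-v_{c,2}(0))^2}}},\qquad \omega_{-1,2}(t)=-\omega_{-1,1}(t)+c_0,$$ $$v_{c,1}(t)=\frac{c_0}{2}t+\nu t+\frac{v_{c,1}(0)-v_{c,2}(0)}{2}\sqrt{1+\frac{2c_1t}{v_{c,1}(0)-v_{c,2}(0)}+\frac{c_0^2t^2}{(v_{c,1}(0)-v_{c,2}(0))^2}}+\frac{v_{c,1}(0)+v_{c,2}(0)}{2},$$ $$v_{c,2}(t)=-v_{c,1}(t)+(2\nu+c_0)t+v_{c,1}(0)+v_{c,2}(0).$$ If $c_0=0$, i.e. $\omega_{-1,1}(0)=-\omega_{-1,2}(0)$: $$\omega_{-1,1}(t)=-\omega_{-1,2}(t)=\frac{\omega_{-1,1}(0)}{\sqrt{1+\frac{4\omega_{-1,1}(0)t}{v_{c,1}(0)-v_{c,2}(0)}}},$$ $$v_{c,1}(t)=\nu t+\frac{v_{c,1}(0)-v_{c,2}(0)}{2}\sqrt{1+\frac{4\omega_{-1,1}(0)t}{v_{c,1}(0)-v_{c,2}(0)}}+\frac{v_{c,1}(0)+v_{c,2}(0)}{2},$$ $$v_{c,2}(t)=-v_{c,1}(t)+2\nu t+v_{c,1}(0)+v_{c,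2}(0).$$
   Context: On the real line $\mathcal{H}f(x)=\frac1\pi\,\mathrm{PV}\int_{-\infty}^\infty\frac{f(x')}{x-x'}\,dx'$ is the Hilbert transform (Fourier symbol $-i\,\mathrm{sgn}(k)$), and $\Lambda=\mathcal{H}\partial_x$ (Fourier symbol $|k|$). The equation is the generalized Constantin–Lax–Majda equation with dissipation, $\omega_t=-au\omega_x+\omega\mathcal{H}(\omega)-\nu\Lambda^\sigma\omega$, $u_x=\mathcal{H}\omega$, with $a=0$ and $\sigma=1$. The poles of $\omega$ are at $x=iv_{c,1}(t)$, $x=iv_{c,2}(t)$ and their complex conjugates; the overline denotes complex conjugation.
   Formalization: For c_0≠0 the formulas are claimed only on time intervals [0,T) where the radicand under the square root avoids (-∞,0]; once it crosses the negative axis the principal root jumps while the true solution continues, so the formula as stated fails there. *)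

(* Defs.v *)
From Stdlib Require Import Reals Lra.
From Coquelicot Require Import Coquelicot.

Open Scope R_scope.
Open Scope C_scope.

(** Derivative relative to [D]: on [D = [0, +oo)] it is one-sided at [0] and the
    ordinary derivative at positive times. *)
Definition is_derive_within (D : R -> Prop) (f : R -> C) (t : R) (l : C) : Prop :=
  @filterdiff R_AbsRing R_NormedModule C_R_NormedModule
    f (within D (locally t)) (fun h => @scal R_AbsRing C_R_NormedModule h l).

Definition nonneg_time (t : R) : Prop := (0 <= t)%R.

(** [is_hilbert f x l]: the principal value at [x' = x] of
    (1/PI) int f(x') / (x - x') dx' exists and equals [l]; for every radius
    [eps] both tails are convergent improper integrals. *)
Definition is_hilbert (f : R -> C) (x : R) (l : C) : Prop :=
  exists J : R -> C,
    (forall eps : R, (0 < eps)%R ->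
       exists Jl Jr : C,
         @is_RInt_gen C_R_NormedModule (fun x' => f x' / RtoC (x - x'))
           (Rbar_locally m_infty) (at_point (x - eps)%R) Jl /\
         @is_RInt_gen C_R_NormedModule (fun x' => f x' / RtoC (x - x'))
           (at_point (x + eps)%R) (Rbar_locally p_infty) Jr /\
         J eps = / PI * (Jl + Jr)) /\
    filterlim J (at_right 0) (@locally C_R_NormedModule l).

(** The operator H d/dx, with Fourier symbol |k|. *)
Definition is_Lambda (f : R -> C) (x : R) (l : C) : Prop :=
  exists f' : R -> C,
    (forall y : R, @is_derive R_AbsRing C_R_NormedModule f y (f' y)) /\
    is_hilbert f' x l.

(** omega_t = omega H(omega) - nu Lambda(omega) at the point [(x, t)], all the
    terms being required to exist. *)
Definition satisfies_gCLM_at (nu : R) (omega : R -> R -> C) (x t : R) : Prop :=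
  exists omega_t Homega Lomega : C,
    is_derive_within nonneg_time (fun s => omega x s) t omega_t /\
    is_hilbert (fun y => omega y t) x Homega /\
    is_Lambda (fun y => omega y t) x Lomega /\
    omega_t = omega x t * Homega - nu * Lomega.

Definition two_pair_ansatz (w1 w2 v1 v2 : R -> C) (x t : R) : C :=
  w1 t / (x - Ci * v1 t) + Cconj (w1 t) / (x + Ci * Cconj (v1 t)) +
  w2 t / (x - Ci * v2 t) + Cconj (w2 t) / (x + Ci * Cconj (v2 t)).

(** [v1 t <> v2 t] is part of being a solution: the right-hand sides are
    undefined otherwise, whereas division in [C] is total. *)
Definition pole_system_solution (nu : R) (w10 w20 v10 v20 : C) (T : R)
    (w1 w2 v1 v2 : R -> C) : Prop :=
  (w1 0%R = w10 /\ w2 0%R = w20 /\ v1 0%R = v10 /\ v2 0%R = v20) /\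
  forall t : R, (0 <= t < T)%R ->
    v1 t <> v2 t /\
    is_derive_within nonneg_time v1 t (nu + w1 t) /\
    is_derive_within nonneg_time v2 t (nu + w2 t) /\
    is_derive_within nonneg_time w1 t (2 * w1 t * w2 t / (v1 t - v2 t)) /\
    is_derive_within nonneg_time w2 t (2 * w1 t * w2 t / (v2 t - v1 t)).

(** Principal square root, with argument in (-PI/2, PI/2]. *)
Definition Csqrt (z : C) : C :=
  (sqrt ((Cmod z + Re z) / 2),
   if Rlt_dec (Im z) 0 then (- sqrt ((Cmod z - Re z) / 2))%R
   else sqrt ((Cmod z - Re z) / 2)).

Lemma Csqrt_principal (z : C) :
  Csqrt z * Csqrt z = z /\
  ((0 < Re (Csqrt z))%R \/ (Re (Csqrt z) = 0%R /\ (0 <= Im (Csqrt z))%R)).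
Proof.
destruct z as [a b]; unfold Csqrt; cbn [Re Im fst snd].
assert (Hm : (Cmod (a, b) * Cmod (a, b) = a * a + b * b)%R).
{ unfold Cmod; cbn [fst snd]; rewrite sqrt_sqrt; nra. }
assert (Hm0 := Cmod_ge_0 (a, b)).
set (m := Cmod (a, b)) in *.
assert (Hp : (0 <= (m + a) / 2)%R) by nra.
assert (Hq : (0 <= (m - a) / 2)%R) by nra.
assert (Hpp := sqrt_sqrt _ Hp); assert (Hqq := sqrt_sqrt _ Hq).
assert (Hpq : (sqrt ((m + a) / 2) * sqrt ((m - a) / 2) = Rabs b / 2)%R).
{ rewrite <- sqrt_mult by assumption.
  replace ((m + a) / 2 * ((m - a) / 2))%R with (Rsqr (b / 2)) by (unfold Rsqr; nra).
  rewrite sqrt_Rsqr_abs; unfold Rdiv; rewrite Rabs_mult, (Rabs_pos_eq (/ 2)); lra. }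
assert (H1 := sqrt_pos ((m + a) / 2)); assert (H2 := sqrt_pos ((m - a) / 2)).
destruct (Rlt_dec b 0) as [Hb | Hb].
- rewrite Rabs_left in Hpq by assumption.
  split; [unfold Cmult; cbn [fst snd]; f_equal; nra | left; nra].
- rewrite Rabs_pos_eq in Hpq by lra.
  split; [unfold Cmult; cbn [fst snd]; f_equal; nra |].
  destruct H1 as [H1 | H1]; [left | right]; lra.
Qed.

(** Complement of the branch cut (-oo, 0] of [Csqrt]. *)
Definition off_branch_cut (z : C) : Prop := ~ (Im z = 0%R /\ (Re z <= 0)%R).

(* Main.v *)
Require Import Defs.
From Stdlib Require Import Reals Lra.
From Coquelicot Require Import Coquelicot.

(** Two independent facts carry the theorem.

    The ansatz is [omega = h + conj h] on the real line, where [h] has its poles in the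
    upper half-plane. The Hilbert transform multiplies such an [h] by [i]
    ([hilbert_simple_pole], and [hilbert_double_pole] for [h_x]); the principal values are
    obtained from explicit antiderivatives. So the equation reduces to
    [h_t = i h^2 - i nu h_x], an identity between rational functions of [x] which partial
    fractions turn into the four ordinary differential equations
    ([gCLM_of_pole_dynamics]).

    The system is integrable. The sum [c0 = w1 + w2] is conserved, so
    [v1 + v2] is affine in time. With [d = v1 - v2] and [p = w1 - w2] one has [d' = p] and
    [(d p)' = c0^2], so [d p] is affine and [d^2] is quadratic in time; [d] is then
    determined by continuity as long as the radicand avoids the branch cut of the
    principal root, and [p] is [d p] divided by [d] ([explicit_of_solution]). Conversely the
    formulas are differentiated ([solution_of_explicit]). When [c0 = 0] the radicand is affine
    in time, and it avoids the cut as soon as it does not vanish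
    ([affine_off_branch_cut]); along a solution it does not vanish because it is a
    nonzero multiple of [d^2]. *)

Open Scope R_scope.

(** * Differentiation of complex functions of time *)

(** Differentiability of a complex function of a real variable along a filter: the
    two filters needed are [locally t] and [within nonneg_time (locally t)], where
    it is [is_derive] and [is_derive_within] respectively. *)
Definition derives (F : (R -> Prop) -> Prop) (f : R -> C) (l : C) : Prop :=
  @filterdiff R_AbsRing R_NormedModule C_R_NormedModule
    f F (fun h => @scal R_AbsRing C_R_NormedModule h l).

Lemma norm_Cmod (z : C) : @norm R_AbsRing C_R_NormedModule z = Cmod z.
Proof.
unfold Cmod; change (sqrt (Rabs (fst z) ^ 2 + Rabs (snd z) ^ 2) = sqrt (fst z ^ 2 + snd z ^ 2)).
now rewrite !pow2_abs.
Qed.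

Lemma is_linear_Cmult (k : C) :
  @is_linear R_AbsRing C_R_NormedModule C_R_NormedModule (fun h => (k * h)%C).
Proof.
split.
- intros x y; change (@eq C (k * (x + y)) (k * x + k * y))%C; ring.
- intros a x; rewrite !scal_R_Cmult; change (@eq C (k * (a * x)) (a * (k * x)))%C; ring.
- exists (Cmod k + 1); split; [generalize (Cmod_ge_0 k); lra |].
  intros x; rewrite !norm_Cmod, Cmod_mult.
  generalize (Cmod_ge_0 x); nra.
Qed.

Lemma is_linear_Cconj : @is_linear R_AbsRing C_R_NormedModule C_R_NormedModule Cconj.
Proof.
split.
- intros x y; exact (Cplus_conj x y).
- intros a x; rewrite !scal_R_Cmult, Cmult_conj.
  now replace (Cconj a) with (RtoC a) by (unfold Cconj, RtoC; cbn; f_equal; ring).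
- exists 1; split; [lra |].
  intros x; rewrite !norm_Cmod, Cmod_conj; lra.
Qed.

(** The remainders of the square, the inverse and the principal root are all
    explicit and quadratic in the increment, so the differentiability of all three follows
    from this bound. *)
Lemma filterdiff_of_quadratic_remainder (g : C -> C) (z m : C) (K : R) :
  0 < K ->
  @locally C_R_NormedModule z
    (fun y => Cmod (g y - g z - m * (y - z)) <= K * Cmod (y - z) ^ 2)%C ->
  @filterdiff R_AbsRing C_R_NormedModule C_R_NormedModule
    g (locally z) (fun h => m * h)%C.
Proof.
intros HK HQ; split; [apply is_linear_Cmult |].
intros z' Hz' eps.
apply (@is_filter_lim_locally_unique R_AbsRing C_R_NormedModule) in Hz'; subst z'.
assert (Hd : 0 < eps / K) by (apply Rdiv_lt_0_compat; [apply eps | exact HK]).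
assert (HB := @locally_ball_norm R_AbsRing C_R_NormedModule z (mkposreal _ Hd)).
generalize (filter_and _ _ HQ HB); apply filter_imp.
intros y [H1 H2]; unfold ball_norm in H2; cbn [pos] in H2.
rewrite norm_Cmod in H2 |- *; rewrite norm_Cmod.
refine (Rle_trans _ _ _ H1 _).
change (minus y z) with (y - z)%C in *.
assert (Hp := Cmod_ge_0 (y - z)).
assert (H3 : K * Cmod (y - z) <= eps).
{ apply Rlt_le, (Rmult_le_compat_l K) in H2; [| lra].
  apply Rle_trans with (1 := H2), Req_le; field; lra. }
nra.
Qed.

Lemma filterdiff_Csqr (z : C) :
  @filterdiff R_AbsRing C_R_NormedModule C_R_NormedModule
    (fun y => y * y)%C (locally z) (fun h => 2 * z * h)%C.
Proof.
apply (filterdiff_of_quadratic_remainder _ _ _ 1); [lra |].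
apply filter_forall; intros y.
replace (y * y - z * z - 2 * z * (y - z))%C with ((y - z) * (y - z))%C by ring.
rewrite Cmod_mult; lra.
Qed.

Lemma filterdiff_Cinv (z : C) : z <> 0 ->
  @filterdiff R_AbsRing C_R_NormedModule C_R_NormedModule
    Cinv (locally z) (fun h => - / (z * z) * h)%C.
Proof.
intros Hz.
assert (Hm : 0 < Cmod z) by now apply Cmod_gt_0.
assert (HK : 0 < 2 / Cmod z ^ 3).
{ apply Rdiv_lt_0_compat; [lra | now apply pow_lt]. }
apply (filterdiff_of_quadratic_remainder _ _ _ _ HK).
assert (Hh : 0 < Cmod z / 2) by lra.
generalize (@locally_ball_norm R_AbsRing C_R_NormedModule z (mkposreal _ Hh)).
apply filter_imp; intros y Hy; unfold ball_norm in Hy; cbn [pos] in Hy.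
rewrite norm_Cmod in Hy; change (minus y z) with (y - z)%C in Hy.
assert (Hy2 : Cmod z / 2 <= Cmod y).
{ assert (Ht := Cmod_triangle y (z - y)).
  replace (y + (z - y))%C with z in Ht by ring.
  replace (z - y)%C with (- (y - z))%C in Ht by ring.
  rewrite Cmod_opp in Ht; lra. }
assert (Hy0 : y <> RtoC 0) by (apply Cmod_gt_0; lra).
replace (/ y - / z - - / (z * z) * (y - z))%C
  with ((y - z) * (y - z) * / (z * z * y))%C by (field; now split).
rewrite !Cmod_mult, Cmod_inv, !Cmod_mult by (repeat apply Cmult_neq_0; assumption).
apply Rle_trans with (Cmod (y - z) * Cmod (y - z) * (2 / Cmod z ^ 3)); [| lra].
apply Rmult_le_compat_l; [apply Rmult_le_pos; apply Cmod_ge_0 |].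
apply Rle_trans with (/ (Cmod z * Cmod z * (Cmod z / 2))).
- apply Rinv_le_contravar; [repeat apply Rmult_lt_0_compat; lra |].
  apply Rmult_le_compat_l; [nra | exact Hy2].
- apply Req_le; field; lra.
Qed.

Lemma Csqrt_re_pos (z : C) : off_branch_cut z -> 0 < Re (Csqrt z).
Proof.
intros Hz; destruct (Csqrt_principal z) as [Hs [H | [H _]]]; [exact H |].
exfalso; apply Hz; rewrite <- Hs; destruct (Csqrt z) as [a b].
cbn in H |- *; subst a; split; [ring | nra].
Qed.

Lemma Csqrt_re_nonneg (z : C) : 0 <= Re (Csqrt z).
Proof.
destruct (Csqrt_principal z) as [_ [H | [H _]]]; lra.
Qed.

Lemma Csqrt_nz (z : C) : off_branch_cut z -> Csqrt z <> 0.
Proof.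
intros Hz H; generalize (Csqrt_re_pos z Hz); rewrite H; cbn; lra.
Qed.

(** With [w = Csqrt z] and [u = Csqrt y], the remainder [u - w - (y - z) / (2 w)] is
    [- (y - z)^2 / (2 w (w + u)^2)], and [|w + u| >= Re w > 0] because principal roots
    have nonnegative real part. The bound thus holds on both sides of the cut. *)
Lemma filterdiff_Csqrt (z : C) : off_branch_cut z ->
  @filterdiff R_AbsRing C_R_NormedModule C_R_NormedModule
    Csqrt (locally z) (fun h => / (2 * Csqrt z) * h)%C.
Proof.
intros Hz.
assert (Hr := Csqrt_re_pos z Hz); assert (Hn := Csqrt_nz z Hz).
destruct (Csqrt_principal z) as [Hs _].
set (w := Csqrt z) in *.
assert (Hw : 0 < Cmod w) by now apply Cmod_gt_0.
assert (HK : 0 < / (2 * Cmod w * Re w ^ 2)).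
{ apply Rinv_0_lt_compat; repeat apply Rmult_lt_0_compat; try apply pow_lt; lra. }
apply (filterdiff_of_quadratic_remainder _ _ _ _ HK).
apply filter_forall; intros y.
destruct (Csqrt_principal y) as [Hy _]; assert (Hy0 := Csqrt_re_nonneg y).
fold w; set (u := Csqrt y) in *.
assert (Hwu : Re w <= Cmod (w + u)).
{ refine (Rle_trans _ _ _ _ (re_le_Cmod _)).
  refine (Rle_trans _ _ _ _ (Rle_abs _)).
  change (Re w <= Re w + Re u); unfold Re in *; lra. }
assert (Hwu0 : (w + u)%C <> 0) by (apply Cmod_gt_0; lra).
replace (u - w - / (2 * w) * (y - z))%C
  with (- ((y - z) * (y - z) * / (2 * w * ((w + u) * (w + u)))))%C
  by (rewrite <- Hy, <- Hs; field; repeat split; try assumption; intros H; injection H; lra).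
rewrite Cmod_opp, !Cmod_mult, Cmod_inv, !Cmod_mult, Cmod_R, (Rabs_pos_eq 2) by
  (try lra; repeat apply Cmult_neq_0; try assumption; intros H; injection H; lra).
rewrite (Rmult_comm (/ _)).
replace (Cmod (y - z) ^ 2) with (Cmod (y - z) * Cmod (y - z)) by ring.
apply Rmult_le_compat_l; [apply Rmult_le_pos; apply Cmod_ge_0 |].
apply Rinv_le_contravar; [repeat apply Rmult_lt_0_compat; try apply pow_lt; lra |].
apply Rmult_le_compat_l; [lra | nra].
Qed.

(** The inner derivative passes through [lg] because [lg] is real-linear, as a differential
    over the reals; for a holomorphic [g] it is multiplication by [g']. *)
Lemma derives_comp (F : (R -> Prop) -> Prop) (PF : ProperFilter F) (t : R)
    (f : R -> C) (l : C) (g lg : C -> C) :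
  is_filter_lim F t ->
  derives F f l ->
  @filterdiff R_AbsRing C_R_NormedModule C_R_NormedModule g (locally (f t)) lg ->
  derives F (fun s => g (f s)) (lg l).
Proof.
intros Ht Hf Hg; unfold derives.
apply (filterdiff_ext_lin _ (fun h : R => lg (@scal R_AbsRing C_R_NormedModule h l))).
- apply (@filterdiff_comp R_AbsRing R_NormedModule C_R_NormedModule C_R_NormedModule F _ f g _ lg);
    [exact Hf |].
  apply (@filterdiff_locally R_AbsRing C_R_NormedModule C_R_NormedModule _ _ g (f t));
    [| exact Hg].
  apply (@filterdiff_continuous_aux R_AbsRing R_NormedModule C_R_NormedModule F _ f); [eexists; exact Hf | exact Ht].
- intros h; apply (@linear_scal R_AbsRing C_R_NormedModule C_R_NormedModule lg), Hg.
Qed.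

Lemma derives_const (F : (R -> Prop) -> Prop) (FF : Filter F) (c : C) :
  derives F (fun _ => c) 0.
Proof.
apply (filterdiff_ext_lin _ (fun _ : R => zero)); [apply filterdiff_const |].
intros h; symmetry; apply (@scal_zero_r R_AbsRing C_R_NormedModule).
Qed.

Lemma derives_id (F : (R -> Prop) -> Prop) (FF : Filter F) : derives F RtoC 1.
Proof.
apply (@filterdiff_ext R_AbsRing R_NormedModule C_R_NormedModule F _
  (fun s : R => @scal R_AbsRing C_R_NormedModule s (RtoC 1))).
- intros s; rewrite scal_R_Cmult; apply Cmult_1_r.
- apply (@filterdiff_scal_l R_AbsRing C_R_NormedModule F FF).
Qed.

Lemma derives_eq (F : (R -> Prop) -> Prop) (f : R -> C) (l l' : C) :
  derives F f l -> l = l' -> derives F f l'.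
Proof. now intros H <-. Qed.

Lemma derives_ext (F : (R -> Prop) -> Prop) (FF : Filter F) (f g : R -> C) (l : C) :
  (forall s, f s = g s) -> derives F f l -> derives F g l.
Proof. intros H; now apply filterdiff_ext. Qed.

Lemma derives_plus (F : (R -> Prop) -> Prop) (FF : Filter F) (f g : R -> C) (l m : C) :
  derives F f l -> derives F g m -> derives F (fun s => f s + g s)%C (l + m)%C.
Proof.
intros Hf Hg; unfold derives.
eapply filterdiff_ext_lin; [exact (filterdiff_plus_fct f g _ _ Hf Hg) |].
intros h; symmetry; apply (@scal_distr_l R_AbsRing C_R_NormedModule).
Qed.

Lemma derives_scal (F : (R -> Prop) -> Prop) (FF : Filter F) (f : R -> C) (k l : C) :
  derives F f l -> derives F (fun s => k * f s)%C (k * l)%C.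
Proof.
intros Hf; unfold derives.
eapply filterdiff_ext_lin.
- refine (@filterdiff_comp R_AbsRing R_NormedModule C_R_NormedModule C_R_NormedModule F _
    f (fun z => k * z)%C _ _ Hf _).
  apply filterdiff_linear, is_linear_Cmult.
- intros h; cbn beta; rewrite !scal_R_Cmult.
  change (@eq C (k * (h * l)) (h * (k * l)))%C; ring.
Qed.

Lemma derives_conj (F : (R -> Prop) -> Prop) (FF : Filter F) (f : R -> C) (l : C) :
  derives F f l -> derives F (fun s => Cconj (f s)) (Cconj l).
Proof.
intros Hf; unfold derives.
eapply filterdiff_ext_lin.
- refine (@filterdiff_comp R_AbsRing R_NormedModule C_R_NormedModule C_R_NormedModule F _
    f Cconj _ _ Hf _).
  apply filterdiff_linear, is_linear_Cconj.
- intros h; cbn beta; apply (@linear_scal R_AbsRing C_R_NormedModule C_R_NormedModule _ is_linear_Cconj).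
Qed.

Lemma derives_minus (F : (R -> Prop) -> Prop) (FF : Filter F) (f g : R -> C) (l m : C) :
  derives F f l -> derives F g m -> derives F (fun s => f s - g s)%C (l - m)%C.
Proof.
intros Hf Hg.
apply (derives_ext F FF (fun s => f s + (- (1)) * g s)%C); [intros s; ring |].
eapply derives_eq.
- apply derives_plus; [exact FF | exact Hf | apply derives_scal; [exact FF | exact Hg]].
- ring.
Qed.

Lemma C2_nz : RtoC 2 <> 0.
Proof. intros H; injection H; lra. Qed.

(** By polarization, [4 f g = (f + g)^2 - (f - g)^2]: the square is then the only
    nonlinear map whose derivative is needed. *)
Lemma derives_mult (F : (R -> Prop) -> Prop) (PF : ProperFilter F) (t : R)
    (f g : R -> C) (l m : C) :
  is_filter_lim F t -> derives F f l -> derives F g m ->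
  derives F (fun s => f s * g s)%C (l * g t + f t * m)%C.
Proof.
intros Ht Hf Hg.
assert (FF : Filter F) by apply PF.
apply (derives_ext F FF (fun s => / (2 * 2) *
   ((f s + g s) * (f s + g s) - (f s - g s) * (f s - g s)))%C).
{ intros s; field; apply C2_nz. }
eapply derives_eq.
- apply derives_scal; [exact FF |]; apply derives_minus; [exact FF | |].
  + refine (derives_comp F PF t _ _ _ _ Ht _ (filterdiff_Csqr _)).
    apply derives_plus; eassumption.
  + refine (derives_comp F PF t _ _ _ _ Ht _ (filterdiff_Csqr _)).
    apply derives_minus; eassumption.
- cbn beta; field; apply C2_nz.
Qed.

Lemma derives_div (F : (R -> Prop) -> Prop) (PF : ProperFilter F) (t : R)
    (f g : R -> C) (l m : C) :
  is_filter_lim F t -> derives F f l -> derives F g m -> g t <> 0 ->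
  derives F (fun s => f s / g s)%C ((l * g t - f t * m) / (g t * g t))%C.
Proof.
intros Ht Hf Hg Hgt.
eapply derives_eq.
- apply (derives_mult F PF t f (fun s => / g s)%C); [exact Ht | exact Hf |].
  exact (derives_comp F PF t _ _ _ _ Ht Hg (filterdiff_Cinv _ Hgt)).
- cbn beta; field; exact Hgt.
Qed.

Lemma derives_Csqrt (F : (R -> Prop) -> Prop) (PF : ProperFilter F) (t : R)
    (f : R -> C) (l : C) :
  is_filter_lim F t -> derives F f l -> off_branch_cut (f t) ->
  derives F (fun s => Csqrt (f s)) (l / (2 * Csqrt (f t)))%C.
Proof.
intros Ht Hf Hc.
eapply derives_eq.
- exact (derives_comp F PF t _ _ _ _ Ht Hf (filterdiff_Csqrt _ Hc)).
- unfold Cdiv; ring.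
Qed.

Lemma locally_proper (t : R) : ProperFilter (locally t).
Proof. apply locally_filter. Qed.

Lemma nonneg_time_proper (t : R) : 0 <= t ->
  ProperFilter (within nonneg_time (locally t)).
Proof.
intros Ht; split; [| apply within_filter, locally_filter].
intros P [eps HP].
exists (t + eps / 2); destruct eps as [e He]; cbn in *.
apply HP; [| unfold nonneg_time; lra].
change (Rabs (t + e / 2 - t) < e); rewrite Rabs_pos_eq; lra.
Qed.

Lemma nonneg_time_lim (t : R) : is_filter_lim (within nonneg_time (locally t)) t.
Proof. intros P HP; unfold within; generalize HP; now apply filter_imp. Qed.

(** Extending [f] by the constant [f 0] to negative times keeps the derivative zero,
    also at [0], so that the fundamental theorem of calculus applies on [[0, t]]. *)
Lemma constant_of_derive_within_zero (f : R -> C) (T : R) :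
  (forall t, 0 <= t < T -> is_derive_within nonneg_time f t 0) ->
  forall t, 0 <= t < T -> f t = f 0.
Proof.
intros Hf t Ht.
set (g := fun s => f (Rmax 0 s)).
assert (Hg : forall s, 0 <= s <= t -> @is_derive R_AbsRing C_R_NormedModule g s zero).
{ intros s Hs; assert (Hs' : 0 <= s < T) by lra.
  assert (PF := nonneg_time_proper s (proj1 Hs)).
  destruct (Hf s Hs') as [_ Hd].
  split; [apply (@is_linear_scal_l R_AbsRing C_R_NormedModule) |].
  intros x Hx eps; apply (@is_filter_lim_locally_unique R_AbsRing R_NormedModule) in Hx; subst x.
  specialize (Hd s (nonneg_time_lim s) eps).
  destruct Hd as [d Hd]; exists d; intros y Hy.
  assert (Hy' : Rabs (Rmax 0 y - s) <= Rabs (y - s)).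
  { unfold Rmax; destruct (Rle_dec 0 y); [lra |].
    rewrite !Rabs_left1; lra. }
  assert (Hb : ball s d (Rmax 0 y)).
  { change (Rabs (Rmax 0 y - s) < d).
    refine (Rle_lt_trans _ _ _ Hy' _); exact Hy. }
  specialize (Hd _ Hb (Rmax_l 0 y)).
  unfold g; rewrite (Rmax_right 0 s) by lra.
  rewrite (@scal_zero_r R_AbsRing C_R_NormedModule) in Hd |- *.
  refine (Rle_trans _ _ _ Hd _).
  apply Rmult_le_compat_l; [apply Rlt_le, eps | exact Hy']. }
assert (HI : @is_RInt C_R_NormedModule (fun _ => zero) 0 t (minus (g t) (g 0))).
{ apply (@is_RInt_derive C_R_CompleteNormedModule).
  - intros s; rewrite Rmin_left, Rmax_right by lra; apply Hg.
  - intros s _; apply continuous_const. }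
apply (@is_RInt_unique C_R_CompleteNormedModule) in HI.
rewrite (@RInt_const C_R_CompleteNormedModule) in HI.
rewrite (@scal_zero_r R_AbsRing C_R_NormedModule) in HI.
unfold g in HI; rewrite (Rmax_right 0 t), (Rmax_right 0 0) in HI by lra.
apply Ceq_minus; now symmetry.
Qed.

(** * The Hilbert transform through antiderivatives *)

Lemma derives_continuous (f : R -> C) (l : C) (y : R) :
  derives (locally y) f l -> @continuous R_UniformSpace C_R_NormedModule f y.
Proof.
intros H; apply (@filterdiff_continuous R_AbsRing R_NormedModule C_R_NormedModule).
eexists; exact H.
Qed.

Lemma is_RInt_gen_of_primitive (Fa Fb : (R -> Prop) -> Prop) (FFa : Filter Fa) (FFb : Filter Fb)
    (g G : R -> C) (la lb : C) :
  filter_prod Fa Fb (fun ab => forall y, Rmin (fst ab) (snd ab) <= y <= Rmax (fst ab) (snd ab) ->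
    derives (locally y) G (g y) /\ @continuous R_UniformSpace C_R_NormedModule g y) ->
  filterlim G Fa (@locally C_R_NormedModule la) ->
  filterlim G Fb (@locally C_R_NormedModule lb) ->
  @is_RInt_gen C_R_NormedModule g Fa Fb (lb - la)%C.
Proof.
intros HD Ha Hb P HP.
assert (HL : filterlim (fun ab : R * R => G (snd ab) - G (fst ab))%C (filter_prod Fa Fb)
               (@locally C_R_NormedModule (lb - la)%C)).
{ apply (filterlim_comp_2 (fun ab : R * R => G (snd ab)) (fun ab : R * R => - G (fst ab))%C
     Cplus (G := @locally C_R_NormedModule lb) (H := @locally C_R_NormedModule (- la)%C)).
  - exact (filterlim_comp _ _ _ _ _ _ _ _ filterlim_snd Hb).
  - refine (filterlim_comp _ _ _ _ Copp _ _ _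
      (filterlim_comp _ _ _ _ _ _ _ _ filterlim_fst Ha) _).
    apply (@filterlim_opp R_AbsRing C_R_NormedModule).
  - apply (@filterlim_plus R_AbsRing C_R_NormedModule). }
specialize (HL P HP); unfold filtermap in HL.
unfold filtermapi; generalize (filter_and _ _ HD HL); apply filter_imp.
intros [a b] [H1 H2]; cbn [fst snd] in *.
exists (G b - G a)%C; split; [| exact H2].
apply (@is_RInt_derive C_R_CompleteNormedModule G g); intros y Hy; now apply H1.
Qed.

(** A principal value computed from an antiderivative [G] of the singular integrand that
    is defined off [x], has limits at both infinities, and whose values on the two
    sides of [x] cancel. Its stability under sums and real-linear maps is that of derivatives
    and limits. *)
Definition hilbert_via_primitive (g : R -> C) (x : R) (l : C) : Prop :=
  exists (G : R -> C) (Lm Lp : C),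
    (forall y, y <> x ->
       derives (locally y) G (@scal R_AbsRing C_R_NormedModule (/ (x - y)) (g y))) /\
    (forall y, @continuous R_UniformSpace C_R_NormedModule g y) /\
    filterlim G (Rbar_locally m_infty) (@locally C_R_NormedModule Lm) /\
    filterlim G (Rbar_locally p_infty) (@locally C_R_NormedModule Lp) /\
    filterlim (fun e => G (x - e)%R - G (x + e)%R)%C (at_right 0) (@locally C_R_NormedModule (RtoC 0)) /\
    l = @scal R_AbsRing C_R_NormedModule (/ PI) (Lp - Lm)%C.

Lemma filterlim_Cplus (T : Type) (F : (T -> Prop) -> Prop) (FF : Filter F) (f g : T -> C) (l m : C) :
  filterlim f F (@locally C_R_NormedModule l) -> filterlim g F (@locally C_R_NormedModule m) ->
  filterlim (fun s => f s + g s)%C F (@locally C_R_NormedModule (l + m)%C).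
Proof.
intros Hf Hg.
exact (filterlim_comp_2 f g Cplus Hf Hg (@filterlim_plus R_AbsRing C_R_NormedModule l m)).
Qed.

Lemma filterlim_linear (T : Type) (F : (T -> Prop) -> Prop) (A : C -> C) (f : T -> C) (l : C) :
  @is_linear R_AbsRing C_R_NormedModule C_R_NormedModule A ->
  filterlim f F (@locally C_R_NormedModule l) ->
  filterlim (fun s => A (f s)) F (@locally C_R_NormedModule (A l)).
Proof.
intros HA Hf; refine (filterlim_comp _ _ _ f A _ _ _ Hf _).
exact (@linear_cont R_AbsRing C_R_NormedModule C_R_NormedModule A l HA).
Qed.

Lemma scal_div (x y : R) (z : C) : y <> x ->
  @scal R_AbsRing C_R_NormedModule (/ (x - y)) z = (z / RtoC (x - y))%C.
Proof.
intros Hy; rewrite scal_R_Cmult, RtoC_inv by lra; unfold Cdiv; apply Cmult_comm.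
Qed.

Lemma is_hilbert_of_primitive (g : R -> C) (x : R) (l : C) :
  hilbert_via_primitive g x l -> is_hilbert g x l.
Proof.
intros (G & Lm & Lp & HG & Hc & Hm & Hp & H0 & ->).
assert (HD : forall y, y <> x ->
  derives (locally y) G (g y / RtoC (x - y))%C /\
  @continuous R_UniformSpace C_R_NormedModule (fun y => g y / RtoC (x - y))%C y).
{ intros y Hy; split; [rewrite <- scal_div by exact Hy; now apply HG |].
  apply (continuous_ext_loc _ (fun y => @scal R_AbsRing C_R_NormedModule (/ (x - y)) (g y))).
  - assert (He : 0 < Rabs (y - x)) by (apply Rabs_pos_lt; lra).
    exists (mkposreal _ He); intros s Hs; apply scal_div; intros ->.
    change (Rabs (x - y) < Rabs (y - x)) in Hs; rewrite Rabs_minus_sym in Hs; lra.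
  - apply (@continuous_scal _ R_AbsRing C_R_NormedModule); [| apply Hc].
    apply (@ex_derive_continuous R_AbsRing R_NormedModule).
    auto_derive; lra. }
exists (fun e => / PI * ((G (x - e)%R - Lm) + (Lp - G (x + e)%R)))%C; split.
- intros e He; exists (G (x - e)%R - Lm)%C, (Lp - G (x + e)%R)%C; repeat split.
  + apply (is_RInt_gen_of_primitive _ _ _ _ _ G); [| exact Hm |].
    * exists (fun a => a < x - e) (fun b => b = x - e); [now exists (x - e) | reflexivity |].
      cbn; intros a b Ha -> y; rewrite Rmin_left, Rmax_right by lra.
      intros Hy; apply HD; lra.
    * intros P HP; exact (locally_singleton _ _ HP).
  + apply (is_RInt_gen_of_primitive _ _ _ _ _ G); [| | exact Hp].
    * exists (fun b => b = x + e) (fun a => x + e < a); [reflexivity | now exists (x + e) |].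
      cbn; intros b a -> Ha y; rewrite Rmin_left, Rmax_right by lra.
      intros Hy; apply HD; lra.
    * intros P HP; exact (locally_singleton _ _ HP).
- apply (filterlim_ext (fun e => / PI * ((G (x - e)%R - G (x + e)%R) + (Lp - Lm)))%C).
  { intros e; f_equal; ring. }
  rewrite scal_R_Cmult.
  replace (RtoC (/ PI) * (Lp - Lm))%C with (/ PI * (0 + (Lp - Lm)))%C
    by (rewrite RtoC_inv by apply PI_neq0; ring).
  apply (filterlim_linear _ _ (fun z => / PI * z)%C _ _ (is_linear_Cmult _)).
  apply filterlim_Cplus; [apply _ | exact H0 | apply filterlim_const].
Qed.

(** Used both for multiplication by a complex residue and for conjugation. *)
Lemma hilbert_via_primitive_linear (A : C -> C) (g : R -> C) (x : R) (l : C) :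
  @is_linear R_AbsRing C_R_NormedModule C_R_NormedModule A ->
  hilbert_via_primitive g x l -> hilbert_via_primitive (fun y => A (g y)) x (A l).
Proof.
intros HA (G & Lm & Lp & HG & Hc & Hm & Hp & H0 & ->).
assert (HAm : forall u v, A (u - v)%C = (A u - A v)%C).
{ intros u v; exact (@linear_minus R_AbsRing C_R_NormedModule C_R_NormedModule A u v HA). }
exists (fun y => A (G y)), (A Lm), (A Lp); refine (conj _ (conj _ (conj _ (conj _ (conj _ _))))).
- intros y Hy.
  rewrite <- (@linear_scal R_AbsRing C_R_NormedModule C_R_NormedModule A HA).
  refine (derives_comp _ (locally_proper y) y _ _ _ _ _ (HG y Hy) _).
  + now intros P.
  + now apply filterdiff_linear.
- intros y; apply filterlim_linear; [exact HA | apply Hc].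
- now apply filterlim_linear.
- now apply filterlim_linear.
- apply (filterlim_ext (fun e => A (G (x - e)%R - G (x + e)%R)%C)).
  { intros e; apply HAm. }
  replace (RtoC 0) with (A 0); [now apply filterlim_linear |].
  exact (@linear_zero R_AbsRing C_R_NormedModule C_R_NormedModule A HA).
- rewrite (@linear_scal R_AbsRing C_R_NormedModule C_R_NormedModule A HA); now rewrite HAm.
Qed.

Lemma hilbert_via_primitive_plus (g h : R -> C) (x : R) (l m : C) :
  hilbert_via_primitive g x l -> hilbert_via_primitive h x m ->
  hilbert_via_primitive (fun y => g y + h y)%C x (l + m)%C.
Proof.
intros (G & Gm & Gp & HG & Gc & HGm & HGp & G0 & ->) (H & Hm & Hp & HH & Hc & HHm & HHp & H0 & ->).
exists (fun y => G y + H y)%C, (Gm + Hm)%C, (Gp + Hp)%C;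
  refine (conj _ (conj _ (conj _ (conj _ (conj _ _))))).
- intros y Hy.
  rewrite (@scal_distr_l R_AbsRing C_R_NormedModule).
  apply derives_plus; [apply locally_filter | now apply HG | now apply HH].
- intros y; apply filterlim_Cplus; [apply locally_filter | apply Gc | apply Hc].
- apply filterlim_Cplus; try assumption; apply _.
- apply filterlim_Cplus; try assumption; apply _.
- apply (filterlim_ext (fun e => (G (x - e)%R - G (x + e)%R) + (H (x - e)%R - H (x + e)%R))%C).
  { intros e; ring. }
  replace (RtoC 0) with (0 + 0)%C by ring.
  apply filterlim_Cplus; try assumption; apply _.
- rewrite !scal_R_Cmult; ring.
Qed.

Lemma filterlim_Cpair (T : Type) (F : (T -> Prop) -> Prop) (FF : Filter F) (f g : T -> R) (a b : R) :
  filterlim f F (locally a) -> filterlim g F (locally b) ->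
  filterlim (fun s => (f s, g s) : C) F (@locally C_R_NormedModule (a, b)).
Proof.
intros Hf Hg P [e HP]; unfold filtermap.
assert (H1 := Hf _ (locally_ball a e)); assert (H2 := Hg _ (locally_ball b e)).
unfold filtermap in H1, H2.
generalize (filter_and _ _ H1 H2); apply filter_imp.
intros s [Ha Hb]; apply HP; now split.
Qed.

Lemma derives_Cpair (f g : R -> R) (y a b : R) :
  is_derive f y a -> is_derive g y b ->
  derives (locally y) (fun s => (f s, g s)) (a, b).
Proof.
intros Hf Hg.
assert (HR : forall (h : R -> R) c, is_derive h y c -> derives (locally y) (fun s => RtoC (h s)) c).
{ intros h c Hh; unfold derives.
  apply (@filterdiff_ext R_AbsRing R_NormedModule C_R_NormedModule (locally y) _
    (fun s : R => @scal R_AbsRing C_R_NormedModule (h s) (RtoC 1))).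
  { intros s; rewrite scal_R_Cmult; apply Cmult_1_r. }
  eapply filterdiff_ext_lin.
  - exact (@filterdiff_scal_l_fct R_AbsRing R_NormedModule C_R_NormedModule (locally y) _
      (RtoC 1) h _ Hh).
  - intros s; cbn beta; rewrite !scal_R_Cmult; change (scal s c) with (s * c).
    rewrite RtoC_mult; apply Cmult_1_r. }
apply (derives_ext _ _ (fun s => RtoC (f s) + Ci * RtoC (g s))%C).
{ intros s; unfold RtoC, Ci, Cplus, Cmult; cbn; f_equal; ring. }
eapply derives_eq.
- apply derives_plus; [apply _ | apply HR; exact Hf |].
  apply derives_scal; [apply _ | apply HR; exact Hg].
- unfold RtoC, Ci, Cplus, Cmult; cbn; f_equal; ring.
Qed.

(** The logarithm of [y - z] on a horizontal line, up to an imaginary constant: the arctangent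
    gives a branch that is smooth along the whole line. *)
Definition pole_log (z : C) (y : R) : C :=
  (ln ((y - Re z) ^ 2 + Im z ^ 2) / 2, atan ((y - Re z) / Im z)).

Lemma pole_denom_nz (z : C) (y : R) : Im z <> 0 -> (RtoC y - z)%C <> 0.
Proof.
intros Hz H; apply Hz; destruct z as [a b]; injection H; cbn; lra.
Qed.

Lemma derives_pole_log (z : C) (y : R) : Im z <> 0 ->
  derives (locally y) (pole_log z) (/ (y - z))%C.
Proof.
intros Hz; unfold pole_log; destruct z as [a b]; cbn [Re Im fst snd] in *.
assert (HN : 0 < (y - a) ^ 2 + b ^ 2).
{ generalize (pow2_ge_0 (y - a)) (pow2_gt_0 b Hz); lra. }
eapply derives_eq.
- apply derives_Cpair.
  + auto_derive; [nra | reflexivity].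
  + apply (is_derive_comp atan (fun s => (s - a) / b)); [apply is_derive_atan |].
    auto_derive; [exact I | reflexivity].
- unfold Cinv, Cminus, Cplus, Copp, RtoC; cbn; unfold scal, mult; cbn; unfold mult, Rsqr; cbn.
  f_equal; field; repeat split; nra.
Qed.

(** * Simple and double poles *)

(** The logarithm of [(y - z) / |y - x|], again up to a constant: its derivative is
    [1 / (y - z) + 1 / (x - y)], and it is bounded at infinity. *)
Definition pv_log (z : C) (x y : R) : C := (pole_log z y - RtoC (ln ((y - x) ^ 2) / 2))%C.

Lemma derives_pv_log (z : C) (x y : R) : Im z <> 0 -> y <> x ->
  derives (locally y) (pv_log z x) (/ (y - z) + / (x - y))%C.
Proof.
intros Hz Hy; unfold pv_log.
assert (Hx : RtoC (x - y) <> 0) by (intros H; injection H; lra).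
apply (derives_eq _ _ (/ (y - z) - RtoC (/ (y - x))))%C.
- apply derives_minus; [apply _ | now apply derives_pole_log |].
  apply (derives_Cpair _ (fun _ => 0)); [| apply (@is_derive_const R_AbsRing R_NormedModule)].
  auto_derive; [| field; lra].
  generalize (pow2_gt_0 (y - x)); cbn; intros H; apply H; lra.
- rewrite RtoC_inv, <- RtoC_minus by lra.
  replace (RtoC (y - x)) with (- RtoC (x - y))%C by (rewrite <- RtoC_opp; f_equal; ring).
  field; split; [exact Hx | now apply pole_denom_nz].
Qed.

(** [s] is the sign of the end of the line. In the variable [u = 1 / y] both components are
    restrictions of functions smooth at [u = 0]; for the arctangent this uses
    [atan w = s PI / 2 - atan (1 / w)]. *)
Lemma pv_log_at_infinity (F : (R -> Prop) -> Prop) (FF : Filter F) (z : C) (x s : R) :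
  0 < Im z -> s * s = 1 ->
  filterlim Rinv F (locally 0) ->
  F (fun y => y <> 0 /\ y <> x /\ 0 < s * (y - Re z)) ->
  filterlim (pv_log z x) F (@locally C_R_NormedModule (0, s * (PI / 2))).
Proof.
intros Hz Hs HF HE; destruct z as [a b]; cbn [Re Im fst snd] in *.
apply (filterlim_ext_loc (fun y =>
  ((fun u => (ln ((1 - a * u) ^ 2 + (b * u) ^ 2) - ln ((1 - x * u) ^ 2)) / 2) (/ y),
   (fun u => s * (PI / 2) - atan (b * u / (1 - a * u))) (/ y)) : C)).
{ revert HE; apply filter_imp; intros y (Hy0 & Hyx & Hya).
  assert (Hya' : y - a <> 0) by (intros H; rewrite H, Rmult_0_r in Hya; lra).
  assert (Hy2 := pow2_gt_0 y Hy0).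
  assert (Hb2 := pow2_gt_0 b (not_eq_sym (Rlt_not_eq _ _ Hz))).
  unfold pv_log, pole_log, Cminus, Cplus, Copp, RtoC; cbn [Re Im fst snd]; f_equal.
  - replace ((y - a) ^ 2 + b ^ 2) with (y ^ 2 * ((1 - a * / y) ^ 2 + (b * / y) ^ 2)) by now field.
    replace ((y - x) ^ 2) with (y ^ 2 * (1 - x * / y) ^ 2) by now field.
    rewrite !ln_mult; [lra | lra | | lra |].
    + replace (1 - x * / y) with ((y - x) / y) by now field.
      apply pow2_gt_0, Rmult_integral_contrapositive; split; [lra | now apply Rinv_neq_0_compat].
    + apply Rplus_le_lt_0_compat; [apply pow2_ge_0 |].
      apply pow2_gt_0, Rmult_integral_contrapositive; split; [lra | now apply Rinv_neq_0_compat].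
  - rewrite Ropp_0, Rplus_0_r.
    replace (b * / y / (1 - a * / y)) with (/ ((y - a) / b)) by (field; repeat split; lra).
    set (w := (y - a) / b).
    assert (Hw : 0 < s * w).
    { unfold w, Rdiv; rewrite <- Rmult_assoc; apply Rmult_lt_0_compat; [exact Hya |].
      now apply Rinv_0_lt_compat. }
    assert (Hs' : s = 1 \/ s = -1).
    { assert (H : (s - 1) * (s + 1) = 0) by lra.
      apply Rmult_integral in H; destruct H; [left | right]; lra. }
    destruct Hs' as [-> | ->].
    + rewrite atan_inv by lra; ring.
    + replace (/ w) with (- / (- w)) by (field; lra).
      rewrite atan_opp, atan_inv, atan_opp by lra; ring. }
assert (H0 : forall h : R -> R, ex_derive h 0 -> filterlim (fun y => h (/ y)) F (locally (h 0))).
{ intros h Hh; refine (filterlim_comp _ _ _ Rinv h _ _ _ HF _).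
  now apply (@ex_derive_continuous R_AbsRing R_NormedModule). }
apply (filterlim_Cpair _ _ _).
- replace 0 with ((ln ((1 - a * 0) ^ 2 + (b * 0) ^ 2) - ln ((1 - x * 0) ^ 2)) / 2) at 1.
  + apply (H0 (fun u => (ln ((1 - a * u) ^ 2 + (b * u) ^ 2) - ln ((1 - x * u) ^ 2)) / 2)).
    auto_derive; repeat split; lra.
  + rewrite !Rmult_0_r; replace ((1 - 0) ^ 2 + 0 ^ 2) with ((1 - 0) ^ 2) by ring; lra.
- replace (s * (PI / 2)) with (s * (PI / 2) - atan (b * 0 / (1 - a * 0))) at 1.
  + apply (H0 (fun u => s * (PI / 2) - atan (b * u / (1 - a * u)))).
    apply (@ex_derive_minus R_AbsRing R_NormedModule); [apply ex_derive_const |].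
    apply (ex_derive_comp atan); [eexists; apply is_derive_atan |].
    auto_derive; lra.
  + rewrite Rmult_0_r; unfold Rdiv; rewrite Rmult_0_l, atan_0; ring.
Qed.

Lemma Rinv_at_p_infty : filterlim Rinv (Rbar_locally p_infty) (locally 0).
Proof. exact (is_lim_inv _ p_infty p_infty (is_lim_id p_infty) ltac:(discriminate)). Qed.

Lemma Rinv_at_m_infty : filterlim Rinv (Rbar_locally m_infty) (locally 0).
Proof. exact (is_lim_inv _ m_infty m_infty (is_lim_id m_infty) ltac:(discriminate)). Qed.

Lemma pv_log_p_infty (z : C) (x : R) : 0 < Im z ->
  filterlim (pv_log z x) (Rbar_locally p_infty) (@locally C_R_NormedModule (0, PI / 2)).
Proof.
intros Hz; replace (PI / 2) with (1 * (PI / 2)) by ring.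
apply pv_log_at_infinity; [apply _ | exact Hz | ring | apply Rinv_at_p_infty |].
exists (Rmax 0 (Rmax x (Re z))); intros y Hy.
generalize (Rmax_l 0 (Rmax x (Re z))) (Rmax_r 0 (Rmax x (Re z))) (Rmax_l x (Re z)) (Rmax_r x (Re z)).
repeat split; lra.
Qed.

Lemma pv_log_m_infty (z : C) (x : R) : 0 < Im z ->
  filterlim (pv_log z x) (Rbar_locally m_infty) (@locally C_R_NormedModule (0, - (PI / 2))).
Proof.
intros Hz; replace (- (PI / 2)) with (-1 * (PI / 2)) by ring.
apply pv_log_at_infinity; [apply _ | exact Hz | ring | apply Rinv_at_m_infty |].
exists (Rmin 0 (Rmin x (Re z))); intros y Hy.
generalize (Rmin_l 0 (Rmin x (Re z))) (Rmin_r 0 (Rmin x (Re z))) (Rmin_l x (Re z)) (Rmin_r x (Re z)).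
repeat split; lra.
Qed.

Lemma symmetric_difference_vanishes (G : R -> C) (x : R) :
  @continuous R_UniformSpace C_R_NormedModule G x ->
  filterlim (fun e => G (x - e)%R - G (x + e)%R)%C (at_right 0) (@locally C_R_NormedModule (RtoC 0)).
Proof.
intros HG.
assert (HH : forall h : R -> R, ex_derive h 0 -> h 0 = x ->
   filterlim (fun e => G (h e)) (at_right 0) (@locally C_R_NormedModule (G x))).
{ intros h Hh Hx; refine (filterlim_comp _ _ _ h G _ _ _ _ HG).
  rewrite <- Hx.
  refine (filterlim_filter_le_1 _ _ (@ex_derive_continuous R_AbsRing R_NormedModule h 0 Hh)).
  apply filter_le_within. }
replace (RtoC 0) with (G x + - (1) * G x)%C by ring.
apply (filterlim_ext (fun e => G (x - e)%R + - (1) * G (x + e)%R)%C).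
{ intros e; ring. }
apply filterlim_Cplus; [apply _ | |].
- apply (HH (fun e => x - e)); [auto_derive; exact I | ring].
- apply (filterlim_linear _ _ (fun u => - (1) * u)%C _ _ (is_linear_Cmult _)).
  apply (HH (fun e => x + e)); [auto_derive; exact I | ring].
Qed.

Lemma pv_log_symmetric (z : C) (x : R) : Im z <> 0 ->
  filterlim (fun e => pv_log z x (x - e)%R - pv_log z x (x + e)%R)%C
    (at_right 0) (@locally C_R_NormedModule (RtoC 0)).
Proof.
intros Hz.
apply (filterlim_ext (fun e => pole_log z (x - e)%R - pole_log z (x + e)%R)%C).
{ intros e; unfold pv_log.
  replace ((x - e - x) ^ 2) with ((x + e - x) ^ 2) by ring; ring. }
apply symmetric_difference_vanishes.
exact (derives_continuous _ _ _ (derives_pole_log z x Hz)).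
Qed.

Lemma derives_simple_pole (z : C) (y : R) : Im z <> 0 ->
  derives (locally y) (fun s => / (s - z))%C (- / ((y - z) * (y - z)))%C.
Proof.
intros Hz; assert (Hn := pole_denom_nz z y Hz).
apply (derives_ext _ _ (fun s => 1 / (s - z))%C); [intros s; unfold Cdiv; ring |].
eapply derives_eq.
- apply (derives_div _ (locally_proper y) y (fun _ => RtoC 1) (fun s => s - z)%C).
  + now intros P.
  + apply derives_const, _.
  + apply derives_minus; [apply _ | apply derives_id, _ | apply derives_const, _].
  + exact Hn.
- cbn beta; field; exact Hn.
Qed.

Lemma simple_pole_at_infinity (F : (R -> Prop) -> Prop) (FF : Filter F) (z : C) :
  filterlim Rinv F (locally 0) -> F (fun y => y <> 0) -> Im z <> 0 ->
  filterlim (fun y => / (RtoC y - z))%C F (@locally C_R_NormedModule (RtoC 0)).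
Proof.
intros HF HE Hz.
apply (filterlim_ext_loc (fun y => (fun u => RtoC u / (1 - z * u))%C (/ y))).
{ revert HE; apply filter_imp; intros y Hy.
  rewrite RtoC_inv by exact Hy.
  assert (Hy' : RtoC y <> 0) by (intros H; injection H; exact Hy).
  field; repeat split; [now apply pole_denom_nz | exact Hy']. }
refine (filterlim_comp _ _ _ Rinv (fun u => RtoC u / (1 - z * u))%C _ _ _ HF _).
replace (@locally C_R_NormedModule (RtoC 0))
  with (@locally C_R_NormedModule ((fun u : R => RtoC u / (1 - z * u)) 0)%C)
  by (f_equal; unfold Cdiv; apply Cmult_0_l).
eapply (derives_continuous (fun u : R => RtoC u / (1 - z * u))%C).
apply (derives_div _ (locally_proper 0) 0 RtoC (fun u => 1 - z * u)%C).
- now intros P.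
- apply derives_id, _.
- apply derives_minus; [apply _ | apply derives_const, _ | apply derives_scal; [apply _ |]].
  apply derives_id, _.
- rewrite Cmult_0_r; intros H; injection H; lra.
Qed.

(** A function holomorphic in the lower half-plane and decaying has only negative
    frequencies, where the symbol is [+ i]. The computation rests on
    [1 / ((y - z) (x - y)) = (1 / (y - z) + 1 / (x - y)) / (x - z)]: the antiderivative
    is [pv_log / (x - z)], whose limits at the two infinities differ by
    [i PI / (x - z)]. *)
Lemma hilbert_simple_pole (z : C) (x : R) : 0 < Im z ->
  hilbert_via_primitive (fun y => / (y - z))%C x (Ci * / (x - z))%C.
Proof.
intros Hz; assert (Hz' : Im z <> 0) by lra; assert (Hx := pole_denom_nz z x Hz').
exists (fun y => / (x - z) * pv_log z x y)%C, (/ (x - z) * (0, - (PI / 2))%R)%C,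
  (/ (x - z) * (0, PI / 2)%R)%C; refine (conj _ (conj _ (conj _ (conj _ (conj _ _))))).
- intros y Hy; assert (Hy' := pole_denom_nz z y Hz').
  assert (Hxy : (RtoC x - RtoC y)%C <> 0) by (intros H; injection H; lra).
  rewrite scal_div, RtoC_minus by exact Hy.
  eapply derives_eq; [apply derives_scal; [apply _ | now apply derives_pv_log] |].
  field; repeat split; assumption.
- intros y; exact (derives_continuous _ _ _ (derives_simple_pole z y Hz')).
- apply (filterlim_linear _ _ (fun u => / (x - z) * u)%C _ _ (is_linear_Cmult _)).
  now apply pv_log_m_infty.
- apply (filterlim_linear _ _ (fun u => / (x - z) * u)%C _ _ (is_linear_Cmult _)).
  now apply pv_log_p_infty.
- apply (filterlim_ext (fun e => / (x - z) * (pv_log z x (x - e)%R - pv_log z x (x + e)%R))%C).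
  { intros e; ring. }
  replace (RtoC 0) with (/ (x - z) * 0)%C by ring.
  apply (filterlim_linear _ _ (fun u => / (x - z) * u)%C _ _ (is_linear_Cmult _)).
  now apply pv_log_symmetric.
- rewrite scal_R_Cmult.
  transitivity (/ (x - z) * (RtoC (/ PI) * ((0, PI / 2)%R - (0, - (PI / 2))%R)))%C; [| ring].
  rewrite (Cmult_comm Ci); f_equal.
  unfold Ci, RtoC, Cminus, Cplus, Copp, Cmult; cbn; f_equal; field; apply PI_neq0.
Qed.

(** One more partial fraction step reduces to the simple pole; the additional
    term [1 / (y - z)] of the antiderivative vanishes at both ends. *)
Lemma hilbert_double_pole (z : C) (x : R) : 0 < Im z ->
  hilbert_via_primitive (fun y => / ((y - z) * (y - z)))%C x (Ci * / ((x - z) * (x - z)))%C.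
Proof.
intros Hz; assert (Hz' : Im z <> 0) by lra; assert (Hx := pole_denom_nz z x Hz').
set (k := (/ ((x - z) * (x - z)))%C).
exists (fun y => k * pv_log z x y + - / (x - z) * / (y - z))%C,
  (k * (0, - (PI / 2))%R + - / (x - z) * 0)%C,
  (k * (0, PI / 2)%R + - / (x - z) * 0)%C; refine (conj _ (conj _ (conj _ (conj _ (conj _ _))))).
- intros y Hy; assert (Hy' := pole_denom_nz z y Hz').
  assert (Hxy : (RtoC x - RtoC y)%C <> 0) by (intros H; injection H; lra).
  rewrite scal_div, RtoC_minus by exact Hy.
  eapply derives_eq.
  + apply derives_plus; [apply _ | |]; apply derives_scal; [apply _ | | apply _ |].
    * now apply derives_pv_log.
    * now apply derives_simple_pole.
  + unfold k; field; repeat split; assumption.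
- intros y.
  eapply (derives_continuous (fun y : R => / ((y - z) * (y - z)))%C).
  apply (derives_ext _ _ (fun s : R => / (s - z) * / (s - z))%C).
  { intros s; assert (Hs := pole_denom_nz z s Hz'); field; exact Hs. }
  apply (derives_mult _ (locally_proper y) y); [now intros P | |]; now apply derives_simple_pole.
- apply filterlim_Cplus; [apply _ | |].
  + apply (filterlim_linear _ _ (fun u => k * u)%C _ _ (is_linear_Cmult _)).
    now apply pv_log_m_infty.
  + apply (filterlim_linear _ _ (fun u => - / (x - z) * u)%C _ _ (is_linear_Cmult _)).
    apply simple_pole_at_infinity; [apply _ | apply Rinv_at_m_infty | | exact Hz'].
    exists 0; intros y Hy; lra.
- apply filterlim_Cplus; [apply _ | |].
  + apply (filterlim_linear _ _ (fun u => k * u)%C _ _ (is_linear_Cmult _)).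
    now apply pv_log_p_infty.
  + apply (filterlim_linear _ _ (fun u => - / (x - z) * u)%C _ _ (is_linear_Cmult _)).
    apply simple_pole_at_infinity; [apply _ | apply Rinv_at_p_infty | | exact Hz'].
    exists 0; intros y Hy; lra.
- apply (filterlim_ext (fun e => k * (pv_log z x (x - e)%R - pv_log z x (x + e)%R) +
    - / (x - z) * (/ (RtoC (x - e) - z) - / (RtoC (x + e) - z)))%C).
  { intros e; ring. }
  replace (RtoC 0) with (k * 0 + - / (x - z) * 0)%C by ring.
  apply filterlim_Cplus; [apply _ | |].
  + apply (filterlim_linear _ _ (fun u => k * u)%C _ _ (is_linear_Cmult _)).
    now apply pv_log_symmetric.
  + apply (filterlim_linear _ _ (fun u => - / (x - z) * u)%C _ _ (is_linear_Cmult _)).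
    apply (symmetric_difference_vanishes (fun y : R => / (y - z))%C).
    exact (derives_continuous _ _ _ (derives_simple_pole z x Hz')).
- rewrite scal_R_Cmult.
  transitivity (k * (RtoC (/ PI) * ((0, PI / 2)%R - (0, - (PI / 2))%R)))%C; [| ring].
  rewrite (Cmult_comm Ci); f_equal.
  unfold Ci, RtoC, Cminus, Cplus, Copp, Cmult; cbn; f_equal; field; apply PI_neq0.
Qed.

(** * From the pole dynamics to the equation *)

Ltac differentiate PF t :=
  repeat match goal with
  | |- Filter _ => apply PF
  | |- is_filter_lim _ _ => assumption
  | |- derives _ (fun _ => ?c) _ => apply derives_const
  | |- derives _ RtoC _ => apply derives_id
  | |- derives _ (fun s => RtoC s) _ => apply derives_id
  | |- derives _ (fun s => _ + _)%C _ => apply derives_plus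
  | |- derives _ (fun s => _ - _)%C _ => apply derives_minus
  | |- derives _ (fun s => ?k * _)%C _ => apply (derives_scal _ _ _ k)
  | |- derives _ (fun s => _ * _)%C _ => apply (derives_mult _ PF t)
  | |- derives _ (fun s => _ / _)%C _ => apply (derives_div _ PF t)
  end.

Lemma Cconj_div (a b : C) : Cconj (a / b) = (Cconj a / Cconj b)%C.
Proof.
destruct a as [a1 a2], b as [b1 b2]; unfold Cdiv, Cinv, Cconj, Cmult; cbn [fst snd].
replace ((- b2) ^ 2) with (b2 ^ 2) by ring.
f_equal; unfold Rdiv; ring.
Qed.

Lemma Cconj_Ci : Cconj Ci = (- Ci)%C.
Proof. unfold Cconj, Ci, Copp; cbn; f_equal; ring. Qed.

Lemma Cconj_RtoC (r : R) : Cconj r = r.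
Proof. unfold Cconj, RtoC; cbn; f_equal; ring. Qed.

(** The part of the ansatz with poles in the upper half-plane; the other two terms are
    its conjugate on the real line. *)
Definition upper_half (w1 w2 v1 v2 : R -> C) (x t : R) : C :=
  (w1 t / (x - Ci * v1 t) + w2 t / (x - Ci * v2 t))%C.

Lemma two_pair_ansatz_split (w1 w2 v1 v2 : R -> C) (x t : R) :
  two_pair_ansatz w1 w2 v1 v2 x t =
  (upper_half w1 w2 v1 v2 x t + Cconj (upper_half w1 w2 v1 v2 x t))%C.
Proof.
assert (H : forall v : C, Cconj (x - Ci * v) = (x + Ci * Cconj v)%C).
{ intros v; rewrite Cminus_conj, Cmult_conj, Cconj_Ci, Cconj_RtoC; ring. }
unfold two_pair_ansatz, upper_half.
rewrite Cplus_conj, !Cconj_div, !H; ring.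
Qed.

(** The Hilbert transform is real, so it commutes with conjugation. *)
Lemma hilbert_plus_conj (g : R -> C) (x : R) (l : C) :
  hilbert_via_primitive g x l ->
  is_hilbert (fun y => g y + Cconj (g y))%C x (l + Cconj l)%C.
Proof.
intros H; apply is_hilbert_of_primitive, hilbert_via_primitive_plus; [exact H |].
exact (hilbert_via_primitive_linear Cconj g x l is_linear_Cconj H).
Qed.

Lemma is_hilbert_ext (f g : R -> C) (x : R) (l : C) :
  (forall y, f y = g y) -> is_hilbert f x l -> is_hilbert g x l.
Proof.
intros H (J & HJ & Hl); exists J; split; [| exact Hl].
intros e He; destruct (HJ e He) as (Jl & Jr & H1 & H2 & H3); exists Jl, Jr.
repeat split; [| | exact H3].
- revert H1; apply is_RInt_gen_ext, filter_forall; intros ab y _; now rewrite H.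
- revert H2; apply is_RInt_gen_ext, filter_forall; intros ab y _; now rewrite H.
Qed.

(** Write [omega = h + conj h] with [h] the upper half. Then [H omega = i h - i conj h], so
    the nonlinear term is [i h^2 + conj (i h^2)] without cross terms, and the equation
    splits into [h_t = i h^2 - i nu h_x] and its conjugate. Matching double poles gives the
    velocities; the mixed term [2 w1 w2 / ((x - i v1) (x - i v2))] of [h^2] is split by
    partial fractions and gives the equations for the residues. *)
Lemma gCLM_of_pole_dynamics (nu : R) (w1 w2 v1 v2 : R -> C) (x t : R) :
  0 <= t -> 0 < Re (v1 t) -> 0 < Re (v2 t) -> v1 t <> v2 t ->
  is_derive_within nonneg_time v1 t (nu + w1 t)%C ->
  is_derive_within nonneg_time v2 t (nu + w2 t)%C ->
  is_derive_within nonneg_time w1 t (2 * w1 t * w2 t / (v1 t - v2 t))%C ->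
  is_derive_within nonneg_time w2 t (2 * w1 t * w2 t / (v2 t - v1 t))%C ->
  satisfies_gCLM_at nu (two_pair_ansatz w1 w2 v1 v2) x t.
Proof.
intros Ht Hv1 Hv2 Hv Dv1 Dv2 Dw1 Dw2.
set (z1 := (Ci * v1 t)%C); set (z2 := (Ci * v2 t)%C).
assert (HI : forall v : C, Im (Ci * v) = Re v).
{ intros [a b]; unfold Im, Re, Ci, Cmult; cbn; ring. }
assert (Hz1 : 0 < Im z1) by (unfold z1; rewrite HI; exact Hv1).
assert (Hz2 : 0 < Im z2) by (unfold z2; rewrite HI; exact Hv2).
assert (Hx1 := fun y => pole_denom_nz z1 y (not_eq_sym (Rlt_not_eq _ _ Hz1))).
assert (Hx2 := fun y => pole_denom_nz z2 y (not_eq_sym (Rlt_not_eq _ _ Hz2))).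
set (h := fun y => upper_half w1 w2 v1 v2 y t).
set (h' := fun y : R => (- w1 t * / ((y - z1) * (y - z1)) + - w2 t * / ((y - z2) * (y - z2)))%C).
assert (PF := nonneg_time_proper t Ht); assert (HF := nonneg_time_lim t).
exists ((Ci * (h x * h x) - nu * (Ci * h' x)) + Cconj (Ci * (h x * h x) - nu * (Ci * h' x)))%C,
  (Ci * h x + Cconj (Ci * h x))%C, (Ci * h' x + Cconj (Ci * h' x))%C.
refine (conj _ (conj _ (conj _ _))).
- change (derives (within nonneg_time (locally t)) (fun s => two_pair_ansatz w1 w2 v1 v2 x s)
    ((Ci * (h x * h x) - nu * (Ci * h' x)) + Cconj (Ci * (h x * h x) - nu * (Ci * h' x)))%C).
  apply (derives_ext _ _ (fun s => upper_half w1 w2 v1 v2 x s + Cconj (upper_half w1 w2 v1 v2 x s))%C).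
  { intros s; symmetry; apply two_pair_ansatz_split. }
  cut (derives (within nonneg_time (locally t)) (fun s => upper_half w1 w2 v1 v2 x s)
    (Ci * (h x * h x) - nu * (Ci * h' x))%C).
  { intros H; apply derives_plus; [apply PF | exact H | apply derives_conj; [apply PF | exact H]]. }
  unfold upper_half; eapply derives_eq.
  + differentiate PF t; [exact Dw1 | exact Dv1 | exact (Hx1 x) | exact Dw2 | exact Dv2 | exact (Hx2 x)].
  + unfold h, h', upper_half; fold z1 z2.
    assert (Hn1 := Hx1 x); assert (Hn2 := Hx2 x).
    assert (Hd : (v1 t - v2 t)%C <> 0) by now apply Cminus_eq_contra.
    assert (Hd' : (v2 t - v1 t)%C <> 0) by (apply Cminus_eq_contra; congruence).
    assert (E1 : (v1 t - v2 t)%C = (((x - z2) - (x - z1)) / Ci)%C)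
      by (unfold z1, z2; field; apply Ci_nz).
    assert (E2 : (v2 t - v1 t)%C = (((x - z1) - (x - z2)) / Ci)%C)
      by (unfold z1, z2; field; apply Ci_nz).
    assert (Hy1 : ((x - z2) - (x - z1))%C <> 0)
      by (intros H; apply Hd; rewrite E1, H; unfold Cdiv; ring).
    assert (Hy2 : ((x - z1) - (x - z2))%C <> 0)
      by (intros H; apply Hd'; rewrite E2, H; unfold Cdiv; ring).
    rewrite E1, E2; revert Hn1 Hn2 Hy1 Hy2.
    generalize (x - z1)%C (x - z2)%C; intros y1 y2 Hn1 Hn2 Hy1 Hy2.
    field; repeat split; first [apply Ci_nz | assumption].
- apply (is_hilbert_ext (fun y => h y + Cconj (h y))%C).
  { intros y; symmetry; apply two_pair_ansatz_split. }
  apply hilbert_plus_conj.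
  replace (Ci * h x)%C with (w1 t * (Ci * / (x - z1)) + w2 t * (Ci * / (x - z2)))%C
    by (unfold h, upper_half; fold z1 z2; unfold Cdiv; ring).
  apply hilbert_via_primitive_plus.
  + exact (hilbert_via_primitive_linear _ _ _ _ (is_linear_Cmult (w1 t)) (hilbert_simple_pole z1 x Hz1)).
  + exact (hilbert_via_primitive_linear _ _ _ _ (is_linear_Cmult (w2 t)) (hilbert_simple_pole z2 x Hz2)).
- exists (fun y => h' y + Cconj (h' y))%C; split.
  + intros y.
    change (derives (locally y) (fun y => two_pair_ansatz w1 w2 v1 v2 y t) (h' y + Cconj (h' y))%C).
    apply (derives_ext _ _ (fun y => h y + Cconj (h y))%C).
    { intros s; symmetry; apply two_pair_ansatz_split. }
    cut (derives (locally y) h (h' y)).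
    { intros H; apply derives_plus; [apply _ | exact H | apply derives_conj; [apply _ | exact H]]. }
    apply (derives_ext _ _ (fun y => w1 t * / (y - z1) + w2 t * / (y - z2))%C); [reflexivity |].
    eapply derives_eq.
    * apply derives_plus; [apply _ | |]; apply derives_scal; [apply _ | | apply _ |];
        apply derives_simple_pole; lra.
    * unfold h'; ring.
  + apply hilbert_plus_conj.
    replace (Ci * h' x)%C
      with (- w1 t * (Ci * / ((x - z1) * (x - z1))) + - w2 t * (Ci * / ((x - z2) * (x - z2))))%C
      by (unfold h'; ring).
    apply hilbert_via_primitive_plus.
    * exact (hilbert_via_primitive_linear _ _ _ _ (is_linear_Cmult (- w1 t)%C) (hilbert_double_pole z1 x Hz1)).
    * exact (hilbert_via_primitive_linear _ _ _ _ (is_linear_Cmult (- w2 t)%C) (hilbert_double_pole z2 x Hz2)).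
- rewrite two_pair_ansatz_split; fold (h x).
  rewrite Cminus_conj, !Cmult_conj, Cconj_Ci, Cconj_RtoC; ring.
Qed.

(** * Integration of the pole dynamics *)

Lemma residue_sum_conserved (nu : R) (w10 w20 v10 v20 : C) (T : R) (w1 w2 v1 v2 : R -> C) :
  pole_system_solution nu w10 w20 v10 v20 T w1 w2 v1 v2 ->
  forall t, 0 <= t < T -> (w1 t + w2 t)%C = (w10 + w20)%C.
Proof.
intros ((<- & <- & _) & HS) t Ht.
refine (constant_of_derive_within_zero (fun s => w1 s + w2 s)%C T _ t Ht).
clear t Ht; intros t Ht; destruct (HS t Ht) as (Hv & _ & _ & D1 & D2).
assert (PF := nonneg_time_proper t (proj1 Ht)).
eapply derives_eq; [apply derives_plus; [apply PF | exact D1 | exact D2] |].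
apply Cminus_eq_contra in Hv.
field; split; [| exact Hv].
intros H; apply Hv; replace (v1 t - v2 t)%C with (- (v2 t - v1 t))%C by ring; rewrite H; ring.
Qed.

Lemma center_of_poles (nu : R) (w10 w20 v10 v20 : C) (T : R) (w1 w2 v1 v2 : R -> C) :
  pole_system_solution nu w10 w20 v10 v20 T w1 w2 v1 v2 ->
  forall t, 0 <= t < T ->
  (v1 t + v2 t)%C = ((2 * nu + (w10 + w20)) * t + (v10 + v20))%C.
Proof.
intros HS t Ht.
assert (Hc := residue_sum_conserved _ _ _ _ _ _ _ _ _ _ HS).
destruct HS as ((_ & _ & E1 & E2) & HS).
assert (H : (v1 t + v2 t - (2 * nu + (w10 + w20)) * t)%C =
            (v1 0%R + v2 0%R - (2 * nu + (w10 + w20)) * 0)%C).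
{ refine (constant_of_derive_within_zero
    (fun s => v1 s + v2 s - (2 * nu + (w10 + w20)) * s)%C T _ t Ht).
  clear t Ht; intros t Ht; destruct (HS t Ht) as (_ & D1 & D2 & _).
  assert (PF := nonneg_time_proper t (proj1 Ht)).
  eapply derives_eq; [differentiate PF t; [exact D1 | exact D2] |].
  rewrite <- (Hc t Ht); ring. }
rewrite E1, E2 in H.
replace (v1 t + v2 t)%C
  with (v1 t + v2 t - (2 * nu + (w10 + w20)) * t + (2 * nu + (w10 + w20)) * t)%C by ring.
rewrite H; ring.
Qed.

(** The value of [((v1 - v2) / D)^2] at time [t], for initial gap [D], residue sum [c0] and
    residue difference [c1]. *)
Definition gap_ratio_sq (c0 c1 D : C) (t : R) : C :=
  (1 + 2 * c1 * t / D + c0 ^ 2 * t ^ 2 / D ^ 2)%C.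

Lemma derives_gap_ratio_sq (F : (R -> Prop) -> Prop) (PF : ProperFilter F) (t : R) (c0 c1 D : C) :
  is_filter_lim F t -> D <> 0 ->
  derives F (gap_ratio_sq c0 c1 D) (2 * (c1 + c0 ^ 2 * t / D) / D)%C.
Proof.
intros Ht HD.
apply (derives_ext _ _ (fun s => 1 + 2 * c1 / D * s + c0 ^ 2 / D ^ 2 * (s * s))%C).
{ intros s; unfold gap_ratio_sq; field; exact HD. }
eapply derives_eq; [differentiate PF t |].
cbn beta; field; exact HD.
Qed.

(** With [d = v1 - v2] and [p = w1 - w2], the system gives [d' = p] and
    [p' = 4 w1 w2 / d = (c0^2 - p^2) / d], hence [(d p)' = c0^2]. *)
Lemma gap_times_residue_difference (nu : R) (w10 w20 v10 v20 : C) (T : R) (w1 w2 v1 v2 : R -> C) :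
  pole_system_solution nu w10 w20 v10 v20 T w1 w2 v1 v2 ->
  forall t, 0 <= t < T ->
  ((v1 t - v2 t) * (w1 t - w2 t))%C = ((v10 - v20) * (w10 - w20) + (w10 + w20) ^ 2 * t)%C.
Proof.
intros HS t Ht.
assert (Hc := residue_sum_conserved _ _ _ _ _ _ _ _ _ _ HS).
destruct HS as ((E1 & E2 & E3 & E4) & HS).
assert (H : ((v1 t - v2 t) * (w1 t - w2 t) - (w10 + w20) ^ 2 * t)%C =
   ((v1 0%R - v2 0%R) * (w1 0%R - w2 0%R) - (w10 + w20) ^ 2 * 0)%C).
{ refine (constant_of_derive_within_zero
    (fun s => (v1 s - v2 s) * (w1 s - w2 s) - (w10 + w20) ^ 2 * s)%C T _ t Ht).
  clear t Ht; intros t Ht; destruct (HS t Ht) as (Hv & D1 & D2 & D3 & D4).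
  assert (PF := nonneg_time_proper t (proj1 Ht)); assert (HF := nonneg_time_lim t).
  eapply derives_eq.
  - differentiate PF t; [exact D1 | exact D2 | exact D3 | exact D4].
  - rewrite <- (Hc t Ht).
    apply Cminus_eq_contra in Hv.
    field; split; [| exact Hv].
    intros H; apply Hv; replace (v1 t - v2 t)%C with (- (v2 t - v1 t))%C by ring; rewrite H; ring. }
rewrite E1, E2, E3, E4 in H.
replace ((v1 t - v2 t) * (w1 t - w2 t))%C
  with ((v1 t - v2 t) * (w1 t - w2 t) - (w10 + w20) ^ 2 * t + (w10 + w20) ^ 2 * t)%C by ring.
rewrite H; ring.
Qed.

(** [(d^2)' = 2 d p] is affine in time by the previous lemma. In particular the radicand
    cannot vanish along a solution. *)
Lemma gap_squared (nu : R) (w10 w20 v10 v20 : C) (T : R) (w1 w2 v1 v2 : R -> C) :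
  v10 <> v20 ->
  pole_system_solution nu w10 w20 v10 v20 T w1 w2 v1 v2 ->
  forall t, 0 <= t < T ->
  ((v1 t - v2 t) * (v1 t - v2 t))%C =
  ((v10 - v20) * (v10 - v20) * gap_ratio_sq (w10 + w20) (w10 - w20) (v10 - v20) t)%C.
Proof.
intros Hv HS t Ht.
assert (HD := Cminus_eq_contra _ _ Hv).
assert (Hp := gap_times_residue_difference _ _ _ _ _ _ _ _ _ _ HS).
destruct HS as ((E1 & E2 & E3 & E4) & HS).
set (Q := gap_ratio_sq (w10 + w20) (w10 - w20) (v10 - v20)) in *.
assert (HQ0 : Q 0 = 1) by (unfold Q, gap_ratio_sq; field; exact HD).
assert (H : ((v1 t - v2 t) * (v1 t - v2 t) - (v10 - v20) * (v10 - v20) * Q t)%C =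
   ((v1 0%R - v2 0%R) * (v1 0%R - v2 0%R) - (v10 - v20) * (v10 - v20) * Q 0%R)%C).
{ refine (constant_of_derive_within_zero
    (fun s => (v1 s - v2 s) * (v1 s - v2 s) - (v10 - v20) * (v10 - v20) * Q s)%C T _ t Ht).
  clear t Ht; intros t Ht; destruct (HS t Ht) as (_ & D1 & D2 & _).
  assert (PF := nonneg_time_proper t (proj1 Ht)); assert (HF := nonneg_time_lim t).
  eapply derives_eq.
  - differentiate PF t; [exact D1 | exact D2 | exact D1 | exact D2 |].
    exact (derives_gap_ratio_sq _ PF t _ _ _ HF HD).
  - transitivity (2 * ((v1 t - v2 t) * (w1 t - w2 t)) -
      2 * ((v10 - v20) * (w10 - w20) + (w10 + w20) ^ 2 * t))%C; [field; exact HD |].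
    rewrite (Hp t Ht); ring. }
rewrite HQ0, E3, E4 in H.
replace ((v1 t - v2 t) * (v1 t - v2 t))%C
  with ((v1 t - v2 t) * (v1 t - v2 t) - (v10 - v20) * (v10 - v20) * Q t
        + (v10 - v20) * (v10 - v20) * Q t)%C by ring.
rewrite H; ring.
Qed.

Lemma Csqrt_1 : Csqrt 1 = 1.
Proof.
unfold Csqrt; rewrite Cmod_1; cbn [Re Im RtoC fst snd].
destruct (Rlt_dec 0 0) as [H | _]; [lra |].
replace ((1 + 1) / 2) with 1 by lra; replace ((1 - 1) / 2) with 0 by lra.
now rewrite sqrt_1, sqrt_0.
Qed.

(** [d] and [D Csqrt Q] have the same square. Their quotient is a square root of [1]
    that equals [1] at time [0], and it is constant because its derivative vanishes. *)
Lemma gap_formula (nu : R) (w10 w20 v10 v20 : C) (T : R) (w1 w2 v1 v2 : R -> C) :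
  v10 <> v20 ->
  (forall t, 0 <= t < T ->
     off_branch_cut (gap_ratio_sq (w10 + w20) (w10 - w20) (v10 - v20) t)) ->
  pole_system_solution nu w10 w20 v10 v20 T w1 w2 v1 v2 ->
  forall t, 0 <= t < T ->
  (v1 t - v2 t)%C =
  ((v10 - v20) * Csqrt (gap_ratio_sq (w10 + w20) (w10 - w20) (v10 - v20) t))%C.
Proof.
intros Hv Hcut HS t Ht.
assert (HD := Cminus_eq_contra _ _ Hv).
assert (Hp := gap_times_residue_difference _ _ _ _ _ _ _ _ _ _ HS).
assert (Hsq := gap_squared _ _ _ _ _ _ _ _ _ _ Hv HS).
destruct HS as ((E1 & E2 & E3 & E4) & HS).
set (Q := gap_ratio_sq (w10 + w20) (w10 - w20) (v10 - v20)) in *.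
set (D := (v10 - v20)%C) in *.
assert (HQ0 : Q 0 = 1) by (unfold Q, gap_ratio_sq; field; exact HD).
assert (HS0 : forall s, 0 <= s < T -> Csqrt (Q s) <> 0) by (intros s Hs; now apply Csqrt_nz, Hcut).
assert (H : ((v1 t - v2 t) / (D * Csqrt (Q t)))%C =
   ((v1 0%R - v2 0%R) / (D * Csqrt (Q 0%R)))%C).
{ refine (constant_of_derive_within_zero
    (fun s => (v1 s - v2 s) / (D * Csqrt (Q s)))%C T _ t Ht).
  clear t Ht; intros t Ht; destruct (HS t Ht) as (_ & D1 & D2 & _).
  assert (PF := nonneg_time_proper t (proj1 Ht)); assert (HF := nonneg_time_lim t).
  eapply derives_eq.
  - differentiate PF t; [exact D1 | exact D2 | | now apply Cmult_neq_0, HS0].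
    apply (derives_Csqrt _ PF t); [exact HF | | now apply Hcut].
    exact (derives_gap_ratio_sq _ PF t _ _ _ HF HD).
  - cbn beta.
    destruct (Csqrt_principal (Q t)) as [HQ _].
    specialize (Hp t Ht); specialize (Hsq t Ht); specialize (HS0 t Ht).
    rewrite <- HQ in Hsq.
    set (S := Csqrt (Q t)) in *; set (d := (v1 t - v2 t)%C) in *.
    set (p := (w1 t - w2 t)%C) in *.
    replace (nu + w1 t - (nu + w2 t))%C with p by (unfold p; ring).
    transitivity ((p * (D * D * (S * S)) - d * (D * (w10 - w20) + (w10 + w20) ^ 2 * t))
       / (D * D * D * S * S * S))%C; [field; split; assumption |].
    rewrite <- Hsq, <- Hp; field; split; assumption. }
rewrite HQ0, Csqrt_1, E3, E4 in H; fold D in H.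
assert (HSt := HS0 t Ht).
replace (v1 t - v2 t)%C with ((v1 t - v2 t) / (D * Csqrt (Q t)) * (D * Csqrt (Q t)))%C
  by (field; split; assumption).
rewrite H; field; exact HD.
Qed.

Definition explicit_solution (nu : R) (w10 w20 v10 v20 : C) (T : R) (w1 w2 v1 v2 : R -> C) : Prop :=
  let c0 := (w10 + w20)%C in
  let c1 := (w10 - w20)%C in
  let D := (v10 - v20)%C in
  let Q := gap_ratio_sq c0 c1 D in
  forall t : R, 0 <= t < T ->
    (w1 t = c0 / 2 + / 2 * ((c1 + c0 ^ 2 * t / D) / Csqrt (Q t)))%C /\
    (w2 t = - w1 t + c0)%C /\
    (v1 t = c0 / 2 * t + nu * t + D / 2 * Csqrt (Q t) + (v10 + v20) / 2)%C /\
    (v2 t = - v1 t + (2 * nu + c0) * t + v10 + v20)%C.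

Lemma explicit_of_solution (nu : R) (w10 w20 v10 v20 : C) (T : R) (w1 w2 v1 v2 : R -> C) :
  v10 <> v20 ->
  (forall t, 0 <= t < T ->
     off_branch_cut (gap_ratio_sq (w10 + w20) (w10 - w20) (v10 - v20) t)) ->
  pole_system_solution nu w10 w20 v10 v20 T w1 w2 v1 v2 ->
  explicit_solution nu w10 w20 v10 v20 T w1 w2 v1 v2.
Proof.
intros Hv Hcut HS t Ht.
set (c0 := (w10 + w20)%C); set (c1 := (w10 - w20)%C).
set (D := (v10 - v20)%C); set (Q := gap_ratio_sq c0 c1 D).
assert (HD := Cminus_eq_contra _ _ Hv : D <> RtoC 0).
assert (Hc := residue_sum_conserved _ _ _ _ _ _ _ _ _ _ HS t Ht); fold c0 in Hc.
assert (Hm := center_of_poles _ _ _ _ _ _ _ _ _ _ HS t Ht); fold c0 in Hm.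
assert (Hp := gap_times_residue_difference _ _ _ _ _ _ _ _ _ _ HS t Ht); fold c0 c1 D in Hp.
assert (Hg := gap_formula _ _ _ _ _ _ _ _ _ _ Hv Hcut HS t Ht); fold c0 c1 D Q in Hg.
assert (HQ := Csqrt_nz _ (Hcut t Ht) : Csqrt (Q t) <> RtoC 0).
assert (H2 := C2_nz).
repeat split.
- rewrite Hg in Hp; rewrite <- Hc at 1.
  replace (c1 + c0 ^ 2 * t / D)%C with ((D * c1 + c0 ^ 2 * t) / D)%C by (field; exact HD).
  rewrite <- Hp; field; repeat split; assumption.
- rewrite <- Hc; ring.
- transitivity (/ 2 * ((v1 t + v2 t) + (v1 t - v2 t)))%C; [field; exact H2 |].
  rewrite Hm, Hg; field; exact H2.
- transitivity (- v1 t + (v1 t + v2 t))%C; [ring |].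
  rewrite Hm; ring.
Qed.

(** The closed formulas are assumed on [[0, T)] only; this is enough since [[0, T)] is a
    neighbourhood of [t] within the nonnegative times. *)
Lemma derives_within_ext (f g : R -> C) (T t : R) (l : C) :
  0 <= t < T -> (forall s, 0 <= s < T -> f s = g s) ->
  derives (within nonneg_time (locally t)) g l ->
  is_derive_within nonneg_time f t l.
Proof.
intros Ht Hfg Hg.
assert (PF := nonneg_time_proper t (proj1 Ht)).
apply (filterdiff_ext_loc g); [| | exact Hg].
- assert (He : 0 < T - t) by lra.
  exists (mkposreal _ He); intros s Hs Hs0; symmetry; apply Hfg.
  change (Rabs (s - t) < T - t) in Hs; unfold nonneg_time in Hs0.
  apply Rabs_def2 in Hs; lra.
- intros s Hs; symmetry; apply Hfg.
  now rewrite (@is_filter_lim_unique R_AbsRing R_NormedModule _ _ s t Hs (nonneg_time_lim t)).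
Qed.

Lemma solution_of_explicit (nu : R) (w10 w20 v10 v20 : C) (T : R) (w1 w2 v1 v2 : R -> C) :
  0 < T -> v10 <> v20 ->
  (forall t, 0 <= t < T ->
     off_branch_cut (gap_ratio_sq (w10 + w20) (w10 - w20) (v10 - v20) t)) ->
  explicit_solution nu w10 w20 v10 v20 T w1 w2 v1 v2 ->
  pole_system_solution nu w10 w20 v10 v20 T w1 w2 v1 v2.
Proof.
intros HT Hv Hcut HE; unfold explicit_solution in HE; cbv zeta in HE.
set (c0 := (w10 + w20)%C) in *; set (c1 := (w10 - w20)%C) in *.
set (D := (v10 - v20)%C) in *; set (Q := gap_ratio_sq c0 c1 D) in *.
assert (HD := Cminus_eq_contra _ _ Hv : D <> RtoC 0).
assert (H2 := C2_nz).
set (N := fun t : R => (c1 + c0 ^ 2 * t / D)%C).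
assert (Ew1 : forall t, 0 <= t < T -> w1 t = (c0 / 2 + / 2 * (N t / Csqrt (Q t)))%C).
{ intros t Ht; apply (HE t Ht). }
assert (Ew2 : forall t, 0 <= t < T -> w2 t = (c0 / 2 - / 2 * (N t / Csqrt (Q t)))%C).
{ intros t Ht; destruct (HE t Ht) as (_ & E & _); rewrite E, Ew1 by exact Ht.
  field; now apply Csqrt_nz, Hcut. }
assert (Ev1 : forall t, 0 <= t < T ->
  v1 t = ((c0 / 2 + nu) * t + (v10 + v20) / 2 + D / 2 * Csqrt (Q t))%C).
{ intros t Ht; destruct (HE t Ht) as (_ & _ & E & _); rewrite E; ring. }
assert (Ev2 : forall t, 0 <= t < T ->
  v2 t = ((c0 / 2 + nu) * t + (v10 + v20) / 2 - D / 2 * Csqrt (Q t))%C).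
{ intros t Ht; destruct (HE t Ht) as (_ & _ & _ & E); rewrite E, Ev1 by exact Ht.
  field; exact H2. }
clear HE.
split.
- assert (H0 : 0 <= 0 < T) by lra.
  assert (HQ0 : Q 0 = 1) by (unfold Q, gap_ratio_sq; field; exact HD).
  assert (HN0 : N 0 = c1) by (unfold N; field; exact HD).
  rewrite Ew1, Ew2, Ev1, Ev2, HQ0, HN0, Csqrt_1 by exact H0.
  unfold c0, c1, D; repeat split; field; exact H2.
- intros t Ht.
  assert (HS := Csqrt_nz _ (Hcut t Ht) : Csqrt (Q t) <> RtoC 0).
  assert (Hgap : (v1 t - v2 t)%C = (D * Csqrt (Q t))%C).
  { rewrite Ev1, Ev2 by exact Ht; field; exact H2. }
  assert (Hgap' : (v2 t - v1 t)%C = (- (D * Csqrt (Q t)))%C) by (rewrite <- Hgap; ring).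
  assert (PF := nonneg_time_proper t (proj1 Ht)); assert (HF := nonneg_time_lim t).
  assert (DN : derives (within nonneg_time (locally t)) N (c0 ^ 2 / D)%C).
  { apply (derives_ext _ _ (fun s => c1 + c0 ^ 2 / D * s)%C).
    - intros s; unfold N; field; exact HD.
    - eapply derives_eq; [differentiate PF t | ring]. }
  assert (DS : derives (within nonneg_time (locally t)) (fun s => Csqrt (Q s))
                 (N t / (D * Csqrt (Q t)))%C).
  { eapply derives_eq.
    - apply (derives_Csqrt _ PF t Q); [exact HF | | now apply Hcut].
      exact (derives_gap_ratio_sq _ PF t c0 c1 D HF HD).
    - unfold N; field; repeat split; assumption. }
  refine (conj _ (conj _ (conj _ (conj _ _)))).
  + intros H; apply (Cmult_neq_0 _ _ HD HS); rewrite <- Hgap, H; ring.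
  + apply (derives_within_ext _ _ T t _ Ht Ev1).
    eapply derives_eq; [differentiate PF t; exact DS |].
    rewrite Ew1 by exact Ht; field; repeat split; assumption.
  + apply (derives_within_ext _ _ T t _ Ht Ev2).
    eapply derives_eq; [differentiate PF t; exact DS |].
    rewrite Ew2 by exact Ht; field; repeat split; assumption.
  + apply (derives_within_ext _ _ T t _ Ht Ew1).
    eapply derives_eq; [differentiate PF t; [exact DN | exact DS | exact HS] |].
    rewrite Hgap, Ew1, Ew2 by exact Ht; field; repeat split; assumption.
  + apply (derives_within_ext _ _ T t _ Ht Ew2).
    eapply derives_eq; [differentiate PF t; [exact DN | exact DS | exact HS] |].
    rewrite Hgap', Ew1, Ew2 by exact Ht; field; repeat split; assumption.
Qed.

(** A ray from [1] can meet the cut only by running along the real axis, and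
    then it passes through [0] first. *)
Lemma affine_off_branch_cut (k : C) (T : R) :
  (forall t, 0 <= t < T -> (1 + k * t)%C <> 0) ->
  forall t, 0 <= t < T -> off_branch_cut (1 + k * t)%C.
Proof.
intros Hk t Ht [HI HR]; destruct k as [a b]; cbn in HI, HR.
assert (Ht0 : 0 < t).
{ destruct (Rle_lt_or_eq_dec 0 t (proj1 Ht)) as [H | <-]; [exact H | lra]. }
assert (Hb : b = 0) by nra.
assert (Ha : a < 0) by nra.
apply (Hk (- / a)).
- split.
  + assert (H := Rinv_lt_0_compat _ Ha); lra.
  + apply Rle_lt_trans with t; [| lra].
    apply Rmult_le_reg_l with (- a); [lra |].
    replace (- a * - / a) with 1 by (field; lra); nra.
- subst b; unfold Cplus, Cmult, RtoC; cbn; f_equal; field; lra.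
Qed.

Theorem mainTheorem5 (nu : R) (w10 w20 v10 v20 : C)
    (Hnu : (0 < nu)%R)
    (Hv10 : (0 < Re v10)%R) (Hv20 : (0 < Re v20)%R) (Hv : v10 <> v20) :
  let c0 := (w10 + w20)%C in
  let c1 := (w10 - w20)%C in
  let D0 := (v10 - v20)%C in
  let Q := (fun t : R => 1 + 2 * c1 * t / D0 + c0 ^ 2 * t ^ 2 / D0 ^ 2)%C in
  let Q0 := (fun t : R => 1 + 4 * w10 * t / D0)%C in
  forall (T : R) (w1 w2 v1 v2 : R -> C), (0 < T)%R ->
  (pole_system_solution nu w10 w20 v10 v20 T w1 w2 v1 v2 ->
     forall t : R, (0 <= t < T)%R ->
     (forall s : R, (0 <= s <= t)%R -> (0 < Re (v1 s))%R /\ (0 < Re (v2 s))%R) ->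
     forall x : R, satisfies_gCLM_at nu (two_pair_ansatz w1 w2 v1 v2) x t) /\
  (pole_system_solution nu w10 w20 v10 v20 T w1 w2 v1 v2 ->
     forall t : R, (0 <= t < T)%R -> (w1 t + w2 t = c0)%C) /\
  (c0 <> 0%C ->
     (forall t : R, (0 <= t < T)%R -> off_branch_cut (Q t)) ->
     (pole_system_solution nu w10 w20 v10 v20 T w1 w2 v1 v2 <->
      forall t : R, (0 <= t < T)%R ->
        (w1 t = c0 / 2 + / 2 * ((c1 + c0 ^ 2 * t / D0) / Csqrt (Q t)))%C /\
        (w2 t = - w1 t + c0)%C /\
        (v1 t = c0 / 2 * t + nu * t + D0 / 2 * Csqrt (Q t) + (v10 + v20) / 2)%C /\
        (v2 t = - v1 t + (2 * nu + c0) * t + v10 + v20)%C)) /\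
  (c0 = 0%C ->
     (pole_system_solution nu w10 w20 v10 v20 T w1 w2 v1 v2 <->
      forall t : R, (0 <= t < T)%R ->
        Q0 t <> 0%C /\
        (w1 t = w10 / Csqrt (Q0 t))%C /\
        (w1 t = - w2 t)%C /\
        (v1 t = nu * t + D0 / 2 * Csqrt (Q0 t) + (v10 + v20) / 2)%C /\
        (v2 t = - v1 t + 2 * nu * t + v10 + v20)%C)).
Proof.
intros c0 c1 D0 Q Q0 T w1 w2 v1 v2 HT.
refine (conj _ (conj _ (conj _ _))).
- intros [_ HS] t Ht Hpos x.
  destruct (HS t Ht) as (Hd & D1 & D2 & D3 & D4).
  destruct (Hpos t (conj (proj1 Ht) (Rle_refl t))) as [P1 P2].
  exact (gCLM_of_pole_dynamics nu w1 w2 v1 v2 x t (proj1 Ht) P1 P2 Hd D1 D2 D3 D4).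
- exact (residue_sum_conserved nu w10 w20 v10 v20 T w1 w2 v1 v2).
- intros _ Hcut; split.
  + exact (explicit_of_solution nu w10 w20 v10 v20 T w1 w2 v1 v2 Hv Hcut).
  + exact (solution_of_explicit nu w10 w20 v10 v20 T w1 w2 v1 v2 HT Hv Hcut).
- intros Hc0.
  assert (HD := Cminus_eq_contra _ _ Hv : D0 <> RtoC 0).
  assert (H2 := C2_nz).
  assert (Hw : c1 = (2 * w10)%C).
  { replace c1 with (2 * w10 - c0)%C by (unfold c0, c1; ring); rewrite Hc0; ring. }
  assert (HQ : forall t, gap_ratio_sq c0 c1 D0 t = Q0 t).
  { intros t; unfold gap_ratio_sq, Q0; rewrite Hc0, Hw; field; exact HD. }
  assert (Hcut : (forall t, 0 <= t < T -> Q0 t <> RtoC 0) ->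
    forall t, 0 <= t < T -> off_branch_cut (gap_ratio_sq c0 c1 D0 t)).
  { intros H t Ht.
    assert (E : forall s : R, Q0 s = (1 + 4 * w10 / D0 * s)%C)
      by (intros s; unfold Q0; field; exact HD).
    rewrite HQ, E; apply (affine_off_branch_cut _ T); [| exact Ht].
    intros s Hs; rewrite <- E; now apply H. }
  split.
  + intros HS.
    assert (Hnz : forall t, 0 <= t < T -> Q0 t <> RtoC 0).
    { intros t Ht H0.
      assert (Hsq := gap_squared _ _ _ _ _ _ _ _ _ _ Hv HS t Ht).
      fold c0 c1 D0 in Hsq; rewrite HQ, H0, Cmult_0_r in Hsq.
      destruct HS as [_ HS]; destruct (HS t Ht) as [Hd _].
      apply Cminus_eq_contra in Hd; exact (Cmult_neq_0 _ _ Hd Hd Hsq). }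
    intros t Ht.
    destruct (explicit_of_solution _ _ _ _ _ _ _ _ _ _ Hv (Hcut Hnz) HS t Ht)
      as (E1 & E2 & E3 & E4).
    fold c0 c1 D0 in E1, E2, E3, E4.
    assert (Hs := Csqrt_nz _ (Hcut Hnz t Ht)).
    rewrite HQ in E1, E3, Hs; rewrite Hc0 in E1, E2, E3, E4; rewrite Hw in E1.
    refine (conj (Hnz t Ht) (conj _ (conj _ (conj _ _)))).
    * rewrite E1; field; repeat split; assumption.
    * rewrite E2; ring.
    * rewrite E3; field; exact H2.
    * rewrite E4; ring.
  + intros HE.
    assert (Hnz : forall t, 0 <= t < T -> Q0 t <> RtoC 0) by (intros t Ht; apply (HE t Ht)).
    apply solution_of_explicit; [exact HT | exact Hv | exact (Hcut Hnz) |].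
    intros t Ht; destruct (HE t Ht) as (_ & E1 & E2 & E3 & E4).
    assert (Hs := Csqrt_nz _ (Hcut Hnz t Ht)).
    fold c0 c1 D0; rewrite HQ in Hs |- *; rewrite Hc0, Hw.
    refine (conj _ (conj _ (conj _ _))).
    * rewrite E1; field; repeat split; assumption.
    * rewrite E2; ring.
    * rewrite E3; field; exact H2.
    * rewrite E4; ring.
Qed.
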